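(* Let $Q(x,y,z)$ be an irreducible quadratic form with real coefficients and signature distinct from $-3$. Then any real polynomial $P(x,y,z)$ of degree $d$, being restricted to the real conic $\mathcal S^{\mathbb R}=\{Q(x,y,z)=1\}$ in $\mathbb R^3_\ast$, has a representation $$P(x,y,z)=\lambda+\sum_{k=1}^{d}\Big[\prod_{j=1}^{k}(a_{k,j}x+b_{k,j}y+c_{k,j}z)\Big]$$ with real $\lambda$, $a_{k,j},b_{k,j},c_{k,j}$. When the surface $\mathcal S^{\mathbb R}$ is an ellipsoid, this representation is unique, up to reordering and rescaling of the multipliers in the products. In such a case, $P$ gives rise to a unique sequence of multipoles $\{w_k\in\overline{\mathcal M}^{\mathbb R}(k)\}_k$.
   Context: $\mathbb R^3_\ast$ is the real 3-space with coordinates $x,y,z$; irreducible means irreducible over $\mathbb C$ (equivalently, non-degenerate). $H_k^{\mathbb R}=\{(\lambda_i)\in(\mathbb R^\ast)^k:\prod\lambda_i=1\}$; $\Sigma_k^{\mathbb R}$ is the group generated by $H_k^{\mathbb R}$ (rescaling) and the symmetric group $S_k$ (permuting). The space of real multipoles is $\mathcal M^{\mathbb R}(k)=[\mathbb R^3\setminus\{0\}]^k/\Sigma_k^{\mathbb R}$, where a vector $(a,b,c)$ encodes the linear form $ax+by+cz$; its points encode nonzero products of $k$ real linear forms. $\overline{\mathcal M}^{\mathbb R}(k)=\mathcal M^{\mathbb R}(k)\cup\{\mathbf 0\}$, where $\mathbf 0$ represents the zero product. Rescaling of multipliers in a product means multiplying them by real constants with product $1$.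
   Formalization: Uniqueness up to reordering and rescaling is stated with all zero products identified (they are represented by the single point 0), since e.g. 0·x and 0·y are not related by rescaling with constants of product 1. *)

(* Defs.v *)
From HB Require Import structures.
From mathcomp Require Import all_boot all_order all_fingroup all_algebra.
From mathcomp Require Import boolp classical_sets reals.
From mathcomp Require Import complex mpoly.

Set Implicit Arguments.
Unset Strict Implicit.
Unset Printing Implicit Defensive.

Import GRing.Theory Num.Theory.
Local Open Scope ring_scope.
Local Open Scope quotient_scope.
Local Open Scope classical_set_scope.

(* Units of {mpoly F[n]} are the nonzero constants.  The zero polynomial is
   excluded, since 0 = 0 * 0. *)
Definition mirreducible (F : fieldType) (n : nat) (p : {mpoly F[n]}) : Prop :=
  p \isn't a GRing.unit /\
  forall q r : {mpoly F[n]}, p = q * r ->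
    q \is a GRing.unit \/ r \is a GRing.unit.

Definition irreducible_over_C (R : realType) (n : nat) (p : {mpoly R[n]}) :
    Prop :=
  mirreducible (map_mpoly (real_complex R) p).

(* Q becomes a diagonal form, with diagonal d, in some linear coordinates; its
   signature is (number of positive d_i) - (number of negative d_i), which does
   not depend on the coordinates by Sylvester's law of inertia. *)
Definition has_signature (R : realType) (n : nat) (Q : {mpoly R[n]}) (s : int) :
    Prop :=
  exists (A : 'M[R]_n) (d : 'rV[R]_n),
    [/\ A \in unitmx,
        forall u : 'rV[R]_n,
          Q.@[(u *m A) 0] = \sum_(i < n) d 0 i * u 0 i ^+ 2
      & s = \sum_(i < n) sgz (d 0 i)].

(* The points of R^n are row vectors u; u 0 is the coordinate function. *)
Definition quadric (R : realType) (n : nat) (Q : {mpoly R[n]}) :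
    set 'rV[R]_n :=
  [set u | Q.@[u 0] = 1].

Definition unit_sphere (R : realType) (n : nat) : set 'rV[R]_n :=
  [set u | \sum_(i < n) u 0 i ^+ 2 = 1].

(* Image of the unit sphere under an invertible affine map. *)
Definition is_ellipsoid (R : realType) (n : nat) (S : set 'rV[R]_n) : Prop :=
  exists (A : 'M[R]_n) (c : 'rV[R]_n),
    A \in unitmx /\ S = [set u *m A + c | u in @unit_sphere R n].

Definition linform (R : realType) (v : 'rV[R]_3) : {mpoly R[3]} :=
  \sum_(i < 3) v 0 i *: 'X_i.

Definition linprod (R : realType) (k : nat) (v : {ffun 'I_k -> 'rV[R]_3}) :
    {mpoly R[3]} :=
  \prod_(j < k) linform (v j).

(* As S_k normalises H_k, every element of the group that they generate is a
   permutation followed by a rescaling; so this is the orbit relation. *)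
Definition reorder_rescale (R : realType) (k : nat)
    (v w : {ffun 'I_k -> 'rV[R]_3}) : Prop :=
  exists (s : 'S_k) (l : 'I_k -> R),
    \prod_(j < k) l j = 1 /\ forall j, w j = l j *: v (s j).

(* A zero product may be written with unrelated factors (0 * x = 0 * y); all
   zero products are represented by the single point 0, hence identified. *)
Definition same_multipliers (R : realType) (k : nat)
    (v w : {ffun 'I_k -> 'rV[R]_3}) : Prop :=
  (linprod v = 0 /\ linprod w = 0) \/ reorder_rescale v w.

Section Multipoles.
Variables (R : realType) (k : nat).

Definition nz_vectors :=
  {v : {ffun 'I_k -> 'rV[R]_3} | [forall j, v j != 0]}.

Definition multipole_rel : rel nz_vectors :=
  fun v w => `[< reorder_rescale (val v) (val w) >].

Lemma multipole_rel_refl : reflexive multipole_rel.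
Proof.
move=> v; apply/asboolP; exists 1%g, (fun=> 1); split; first by rewrite big1.
by move=> j; rewrite perm1 scale1r.
Qed.

Lemma reorder_rescale_sym (v w : {ffun 'I_k -> 'rV[R]_3}) :
  reorder_rescale v w -> reorder_rescale w v.
Proof.
move=> [s [l [l1 wE]]].
have l_neq0 j : l j != 0.
  apply/eqP=> lj0; have := oner_neq0 R.
  by rewrite -l1 (bigD1 j) //= lj0 mul0r eqxx.
exists s^-1%g, (fun j => (l (s^-1%g j))^-1); split; last first.
  by move=> j; rewrite wE permKV scalerA mulVf // scale1r.
rewrite prodfV -[in RHS](invr1 R) -[in RHS]l1; congr (_^-1).
by rewrite [RHS](reindex_inj (@perm_inj _ s^-1%g)).
Qed.

Lemma multipole_rel_sym : ssrbool.symmetric multipole_rel.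
Proof.
by move=> v w; apply/asboolP/asboolP; exact: reorder_rescale_sym.
Qed.

Lemma multipole_rel_trans : transitive multipole_rel.
Proof.
move=> w v x /asboolP[s [l [l1 wE]]] /asboolP[t [m [m1 xE]]]; apply/asboolP.
exists (t * s)%g, (fun j => m j * l (t j)); split.
  by rewrite big_split /= m1 mul1r -[RHS]l1 [RHS](reindex_inj (@perm_inj _ t)).
by move=> j; rewrite xE wE scalerA permM.
Qed.

Canonical multipole_equiv :=
  EquivRel multipole_rel multipole_rel_refl multipole_rel_sym
    multipole_rel_trans.

Definition multipole := {eq_quot multipole_equiv}.

(* None is the additional point 0. *)
Definition multipole_bar := option multipole.

Definition multipole_of (v : {ffun 'I_k -> 'rV[R]_3}) : multipole_bar :=
  omap (\pi_multipole) (insub v : option nz_vectors).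

End Multipoles.

(* P = lam + sum of products on the surface Q = 1.  The index k : 'I_d stands
   for the product of k.+1 linear forms, so that 1 <= k.+1 <= d. *)
Definition represents (R : realType) (d : nat) (Q P : {mpoly R[3]}) (lam : R)
    (v : forall k : 'I_d, {ffun 'I_k.+1 -> 'rV[R]_3}) : Prop :=
  forall u : 'rV[R]_3, quadric Q u ->
    P.@[u 0] = lam + \sum_(k < d) (linprod (v k)).@[u 0].

(* Main.v *)
Require Import Defs.
From HB Require Import structures.
From mathcomp Require Import all_boot all_order all_fingroup all_algebra.
From mathcomp Require Import boolp classical_sets reals.
From mathcomp Require Import complex mpoly.
From mathcomp Require Import ring lra zify.

Set Implicit Arguments.
Unset Strict Implicit.
Unset Printing Implicit Defensive.

Import Order.TTheory GRing.Theory Num.Theory.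
Local Open Scope ring_scope.
Local Open Scope complex_scope.

(** In suitable linear coordinates the form [Q] is [x^2 + y^2 + z^2] or
    [e (x y + z^2)] with [e = 1] or [e = - 1]: irreducibility rules out zero
    diagonal entries, and the signature rules out negative definite forms.  Write
    [Q], up to sign, as [X Y + Z^2], where in the definite case [X = x + i y] and
    [Y = x - i y].  Its conic at infinity [X Y + Z^2 = 0] is parametrised by
    [(X, Y, Z) = (1, - t^2, t)], and a form of degree [k] restricts to it as a
    polynomial in [t] of degree at most [2 k].  Since [X Y + Z^2] is constant on
    the quadric, two forms of degree [k] with the same restriction differ there by
    a polynomial of lower degree, and each polynomial [p] lifts to a form
    ([conic_lift_surjective], [conic_liftM]).  A linear form restricts to a
    polynomial of degree at most two, so it suffices to factor [p] into [k] such
    polynomials that come from real linear forms; subtracting the product and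
    descending on the degree gives the representation ([leading_products_sum]).

    In the indefinite case the parametrisation is real, and a real polynomial of
    degree at most [2 k] is a product of [k] real ones of degree at most two,
    non-real roots coming in conjugate pairs ([real_quadratic_factorisation]).  In
    the definite case complex conjugation acts on the parameter as the antipodal
    map [t |-> - 1 / conj t], which has no fixed point.  The restriction of a real
    form has a root set stable under this map, and each antipodal pair is the zero
    set of a real linear form, unique up to a real factor.  Hence the
    factorisation exists ([star_factorisation]) and is unique
    ([null_factorisation_unique]).

    An ellipsoid is bounded and non-empty, so its form is positive definite and
    may be taken to be the unit sphere.  If two sums of products agree on the
    sphere, composing with the stereographic projection gives a polynomial
    identity in two real, hence complex, parameters.  Where the denominator
    [a^2 + b^2 + 1] vanishes only the leading products survive, so that these agree
    on the conic ([leading_null_poly]) and have the same factors; they can be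
    removed, and the remaining terms are compared in the same way. *)

(** * Polynomials vanishing at all real points *)

Lemma poly_vanishing_eq0 (K : numDomainType) (L : idomainType)
    (f : {rmorphism K -> L}) (p : {poly L}) :
  injective f -> (forall x, p.[f x] = 0) -> p = 0.
Proof.
move=> f_inj p0; apply: contraTeq isT => p_neq0.
have := @max_poly_roots _ p [seq f i%:R | i <- iota 0 (size p)] p_neq0.
rewrite size_map size_iota ltnn; apply.
  by apply/allP=> _ /mapP[i _ ->]; rewrite /root p0.
rewrite map_inj_uniq ?iota_uniq // => i j /f_inj/eqP.
by rewrite eqr_nat => /eqP.
Qed.

Lemma meval_muni (K : comNzRingType) n (p : {mpoly K[n.+1]})
    (v : 'I_n.+1 -> K) :
  p.@[v] = (map_poly (meval (v \o widen_ord (leqnSn n))) (muni p)).[v ord_max].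
Proof.
rewrite muniE mevalE raddf_sum /= horner_sum; apply: eq_bigr => m _.
rewrite map_polyZ /= map_polyXn hornerZ hornerXn mevalZ mevalX big_ord_recr /=.
rewrite -mulrA; congr (_ * (_ * _)); apply: eq_bigr => i _; rewrite mnmE.
by congr (v _ ^+ m _); apply: val_inj.
Qed.

(** The coefficient of [p] at [m] is a coefficient of the coefficient of
    [muni p] at the last exponent of [m]. *)
Lemma muni_inj (K : nzRingType) n (p : {mpoly K[n.+1]}) : muni p = 0 -> p = 0.
Proof.
move=> p0; apply/mpolyP=> m; rewrite mcoeff0.
pose r (m : 'X_{1..n.+1}) := [multinom m (widen_ord (leqnSn n) i) | i < n].
have : (muni p)`_(m ord_max)@_(r m) = 0 by rewrite p0 coef0 mcoeff0.
rewrite muniE coef_sum raddf_sum /= => E; rewrite -[RHS]E {E}.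
have -> : p@_m = \sum_(i <- msupp p | i == m) p@_i.
  have [mp|mp] := boolP (m \in msupp p).
    rewrite (big_rem m) //= eqxx big_seq_cond big1 ?addr0 // => i.
    by case/andP=> /[swap]/eqP ->; rewrite mem_rem_uniq ?msupp_uniq // inE eqxx.
  rewrite big_seq_cond big1 ?(memN_msupp_eq0 mp) // => i /andP[]/[swap]/eqP->.
  by rewrite (negPf mp).
rewrite [LHS]big_mkcond; apply: eq_bigr => i _.
rewrite coefZ coefXn -/(r i).
have [->|im] := eqVneq i m; first by rewrite eqxx mulr1 mcoeffZ mcoeffX eqxx mulr1.
case: eqVneq => [e|_]; last by rewrite mulr0 mcoeff0.
rewrite mulr1 mcoeffZ mcoeffX; case: eqVneq => [e'|_]; last by rewrite mulr0.
case/eqP: im; apply/mnmP => j; case: (unliftP ord_max j) => [k ->|->//].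
move/mnmP/(_ k): e'; rewrite !mnmE.
suff -> : widen_ord (leqnSn n) k = lift ord_max k by [].
by apply: val_inj; rewrite /= /bump leqNgt ltn_ord.
Qed.

Lemma mpoly_vanishing_eq0 (K : numDomainType) n (p : {mpoly K[n]}) :
  (forall v : 'rV[K]_n, p.@[v 0] = 0) -> p = 0.
Proof.
elim: n p => [|n IHn] p p0.
  apply/mpolyP=> m; rewrite mcoeff0; have := p0 0.
  rewrite [p]nvar0_mpolyC mevalC => ->; by rewrite mpolyC0 mcoeff0.
apply/muni_inj/polyP=> k; rewrite coef0; apply: IHn => v.
have : map_poly (meval (v 0)) (muni p) = 0.
  apply: (@poly_vanishing_eq0 K K idfun) => // x.
  have := p0 (\row_i (if unlift ord_max i is Some j then v 0 j else x)).
  rewrite meval_muni mxE unlift_none.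
  rewrite (_ : map_poly _ _ = map_poly (meval (v 0)) (muni p)) //.
  apply: eq_map_poly => q; apply: meval_eq => j /=; rewrite mxE.
  have -> : widen_ord (leqnSn n) j = lift ord_max j.
    by apply: val_inj; rewrite /= /bump leqNgt ltn_ord.
  by rewrite liftK.
by move/polyP/(_ k); rewrite coef_map coef0.
Qed.

(** * Normal forms of the quadratic form *)

Lemma ord3_sum (V : nmodType) (F : 'I_3 -> V) (i j l : 'I_3) :
  i != j -> i != l -> j != l -> \sum_k F k = F i + F j + F l.
Proof.
move=> ij il jl.
rewrite (bigD1 i) //= (bigD1 j) 1?eq_sym //= (bigD1 l) /=; last first.
  by rewrite !(eq_sym l) il jl.
rewrite big_pred0 ?addr0 ?addrA // => x; apply/negP => /andP[/andP[xi xj] xl].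
have /card_uniqP u4 : uniq [:: x; i; j; l].
  by rewrite /= !inE !negb_or xi xj xl ij il jl.
by have := max_card (mem [:: x; i; j; l]); rewrite u4 card_ord.
Qed.

Lemma ord3_third (i j : 'I_3) : exists2 l : 'I_3, i != l & j != l.
Proof.
have : (0 < #|~: [set i; j]%SET|)%N.
  have := cardsC [set i; j]%SET; rewrite cards2 card_ord => e.
  by rewrite lt0n; apply: contra_eqN e => /eqP ->; case: (i != j).
by case/card_gt0P => l; rewrite !inE negb_or !(eq_sym l) => /andP[]; exists l.
Qed.

Lemma ord3_others (l : 'I_3) : exists i j : 'I_3, [/\ i != j, i != l & j != l].
Proof.
have [i li _] := ord3_third l l; have [j lj ij] := ord3_third l i.
by exists i, j; rewrite !(eq_sym _ l).
Qed.

Lemma meval_linform (R : realType) (v u : 'rV[R]_3) :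
  (linform v).@[u 0] = \sum_i v 0 i * u 0 i.
Proof. by rewrite raddf_sum; apply: eq_bigr => i _; rewrite /= mevalZ mevalXU. Qed.

Lemma unit_meval_neq0 (K : fieldType) n (p : {mpoly K[n]}) v :
  p \is a GRing.unit -> p.@[v] != 0.
Proof. by move/(rmorph_unit (meval v)); rewrite unitfE. Qed.

(** The form is the product of [a *: p + b *: q] and [a *: p - b *: q]; neither is
    a unit, since both vanish at the origin. *)
Lemma sum_squares_reducible (K : fieldType) n (p q : {mpoly K[n]})
    (x y a b : K) :
  a ^+ 2 = x -> b ^+ 2 = - y -> p.@[fun=> 0] = 0 -> q.@[fun=> 0] = 0 ->
  ~ mirreducible (x *: p ^+ 2 + y *: q ^+ 2).
Proof.
move=> <- /eqP; rewrite -eqr_oppLR => /eqP <- p0 q0 [_].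
move=> /(_ (a *: p + b *: q) (a *: p - b *: q)) irr.
have unit0 r := @unit_meval_neq0 K n r (fun=> 0).
case: irr => [|/unit0|/unit0].
- by rewrite -!mul_mpolyC mpolyCN !rmorphXn /=; ring.
- by rewrite mevalD !mevalZ p0 q0 !mulr0 addr0 eqxx.
- by rewrite mevalB !mevalZ p0 q0 !mulr0 subr0 eqxx.
Qed.

Section NormalForm.
Variables (R : realType) (Q : {mpoly R[3]}) (A : 'M[R]_3) (d : 'rV[R]_3).
Hypotheses (A_unit : A \in unitmx)
  (QA : forall u : 'rV[R]_3, Q.@[(u *m A) 0] = \sum_i d 0 i * u 0 i ^+ 2).

Lemma diagonal_sum_squares :
  Q = \sum_i d 0 i *: linform (row i (invmx A)^T) ^+ 2.
Proof.
apply/eqP; rewrite -subr_eq0; apply/eqP/mpoly_vanishing_eq0 => v.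
rewrite mevalB -[in Q.@[_]](mulmxKV A_unit v) QA (raddf_sum (meval (v 0))) /=.
apply/eqP; rewrite subr_eq0; apply/eqP/eq_bigr => i _.
rewrite mevalZ rmorphXn /= meval_linform; congr (_ * _ ^+ 2).
rewrite mxE; apply: eq_bigr => j _; rewrite !mxE mulrC //.
Qed.

(** A form with a zero diagonal entry is a sum of two squares, hence over the
    complex numbers a product of two linear forms. *)
Lemma irreducible_diagonal_neq0 l : irreducible_over_C Q -> d 0 l != 0.
Proof.
move=> irr; apply/eqP => dl0; move: irr; rewrite /irreducible_over_C.
have [i [j [ij il jl]]] := ord3_others l.
rewrite diagonal_sum_squares (ord3_sum _ ij il jl) dl0 scale0r addr0.
have mD p q : map_mpoly (real_complex R) (p + q) =
    map_mpoly (real_complex R) p + map_mpoly (real_complex R) q :> {mpoly _[3]}.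
  exact: rmorphD.
have mX p : map_mpoly (real_complex R) (p ^+ 2) =
    map_mpoly (real_complex R) p ^+ 2 :> {mpoly _[3]} by exact: rmorphXn.
rewrite mD !map_mpolyZ !mX.
have L0 v : (map_mpoly (real_complex R) (linform v)).@[fun=> 0] = 0.
  rewrite /linform (rmorph_sum (map_mpoly (real_complex R))).
  rewrite (raddf_sum (meval (fun=> 0))) big1 //= => r _.
  by rewrite map_mpolyZ map_mpolyX mevalZ mevalXU mulr0.
exact: (sum_squares_reducible (sqr_sqrtc _) (sqr_sqrtc _)).
Qed.

Lemma definite_normal_form : (forall i, 0 < d 0 i) ->
  exists2 B : 'M[R]_3, B \in unitmx &
    forall u : 'rV[R]_3, Q.@[(u *m B) 0] = \sum_i u 0 i ^+ 2.
Proof.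
move=> d_gt0; exists (diag_mx (\row_i (Num.sqrt (d 0 i))^-1) *m A).
  rewrite unitmx_mul A_unit andbT unitmxE det_diag unitfE.
  by apply/prodf_neq0 => i _; rewrite mxE invr_eq0 sqrtr_eq0 -ltNge.
move=> u; rewrite mulmxA QA; apply: eq_bigr => i _.
rewrite mul_mx_diag !mxE exprMn exprVn sqr_sqrtr ?ltW //.
by rewrite mulrCA mulfV ?mulr1 // gt_eqF.
Qed.

(** The entries of opposite signs at [i] and [j] give a hyperbolic plane, on which
    the form is a product; the sign [e] is that of the third entry. *)
Lemma indefinite_normal_form i j :
  (forall i, d 0 i != 0) -> 0 < d 0 i -> d 0 j < 0 ->
  exists B : 'M[R]_3, exists2 e : R, B \in unitmx /\ e ^+ 2 = 1 &
    forall u : 'rV[R]_3,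
      Q.@[(u *m B) 0] = e * (u 0 0 * u 0 1 + u 0 2%:R ^+ 2).
Proof.
move=> d_neq0 di dj; have [l il jl] := ord3_third i j.
have ij : i != j by apply: contraTneq di => ->; rewrite -leNgt ltW.
pose e := Num.sg (d 0 l).
have e2 : e ^+ 2 = 1 by rewrite sqr_sg d_neq0.
pose s k := (Num.sqrt `|d 0 k|).
have s0 k : s k != 0 by rewrite sqrtr_eq0 -ltNge normr_gt0.
have s2 k : s k ^+ 2 = `|d 0 k| by rewrite sqr_sqrtr.
pose f (u : 'rV[R]_3) k := if k == i then (u 0 1 + e * u 0 0) / 2 / s i
  else if k == j then (u 0 1 - e * u 0 0) / 2 / s j else u 0 2%:R / s l.
pose M : 'M[R]_3 := \matrix_(r, c) f (delta_mx 0 r) c.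
have ME u k : (u *m M) 0 k = f u k.
  rewrite mxE big_ord_recr big_ord_recr big_ord_recr big_ord0 /= add0r.
  have -> : widen_ord (leqnSn 2) (widen_ord (leqnSn 1) ord_max) = 0 :> 'I_3.
    by apply: val_inj.
  have -> : widen_ord (leqnSn 2) ord_max = 1 :> 'I_3 by apply: val_inj.
  have -> : ord_max = 2%:R :> 'I_3 by apply: val_inj.
  rewrite !mxE /f; case: ifP => _; last case: ifP => _; rewrite !mxE /=; ring.
exists (M *m A), e; first split => //.
  rewrite unitmx_mul A_unit andbT -row_free_unit -kermx_eq0.
  apply/rowV0P => u /sub_kermxP uM.
  have fu k : f u k = 0 by rewrite -ME uM mxE.
  have := fu i; have := fu j; have := fu l; rewrite /f !eqxx.
  rewrite !(eq_sym l) (negPf il) (negPf jl) (eq_sym j) (negPf ij).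
  move=> /eqP; rewrite mulf_eq0 invr_eq0 (negPf (s0 _)) orbF => /eqP u2.
  move=> /eqP; rewrite !mulf_eq0 !invr_eq0 (negPf (s0 _)) pnatr_eq0 !orbF.
  move=> /eqP u1 /eqP.
  rewrite !mulf_eq0 !invr_eq0 (negPf (s0 _)) pnatr_eq0 !orbF => /eqP u0.
  have u10 : u 0 1 = 0 by lra.
  have /eqP : e * u 0 0 = 0 by lra.
  rewrite mulf_eq0 /e sgr_eq0 (negPf (d_neq0 _)) /= => /eqP u00.
  apply/rowP => k; rewrite !mxE; case: k => [[|[|[|//]]] hk].
  - by rewrite -[RHS]u00; congr (u _ _); apply: val_inj.
  - by rewrite -[RHS]u10; congr (u _ _); apply: val_inj.
  - by rewrite -[RHS]u2; congr (u _ _); apply: val_inj.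
move=> u; rewrite mulmxA QA (ord3_sum _ ij il jl) !ME /f !eqxx.
rewrite !(eq_sym l) (negPf il) (negPf jl) (eq_sym j) (negPf ij).
have ei : d 0 i = s i ^+ 2 by rewrite s2 gtr0_norm.
have ej : d 0 j = - s j ^+ 2 by rewrite s2 ltr0_norm // opprK.
have el : d 0 l = e * s l ^+ 2 by rewrite s2 /e -numEsg.
rewrite ei ej el; field.
by rewrite !s0.
Qed.

End NormalForm.

(** * Polynomial functions on a quadric and its conic at infinity *)

Section DegreeFiltration.
Variables (R : realType) (K : comNzRingType) (io : {rmorphism R -> K}).
Variable S : 'rV[R]_3 -> Prop.
Implicit Types (f g : 'rV[R]_3 -> K).

(** Functions that coincide on [S] with a polynomial of degree less than [k] in
    the coordinates, with coefficients in [K]; for [k = 0], those vanishing on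
    [S]. *)
Fixpoint deg_lt k f : Prop :=
  if k is k'.+1 then
    exists (g : 'I_3 -> 'rV[R]_3 -> K) (c : K), (forall i, deg_lt k' (g i)) /\
      forall u, S u -> f u = \sum_i io (u 0 i) * g i u + c
  else forall u, S u -> f u = 0.

(** A [K]-linear combination of the real coordinates. *)
Definition linear_form (X : 'rV[R]_3 -> K) :=
  exists a : 'I_3 -> K, forall u, X u = \sum_i a i * io (u 0 i).

Lemma deg_lt_ext k f g : deg_lt k f -> (forall u, S u -> f u = g u) -> deg_lt k g.
Proof.
case: k => [f0 fg u Su|k [h [c [hk fE]]] fg]; first by rewrite -fg ?f0.
by exists h, c; split=> // u Su; rewrite -fg // fE.
Qed.

Lemma deg_ltD k f g : deg_lt k f -> deg_lt k g -> deg_lt k (fun u => f u + g u).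
Proof.
elim: k f g => [|k IHk] f g /=; first by move=> f0 g0 u Su; rewrite f0 ?g0 ?addr0.
move=> [p [c [pk fE]]] [q [d [qk gE]]].
exists (fun i u => p i u + q i u), (c + d); split=> [i|u Su]; first exact: IHk.
rewrite fE // gE // addrACA -big_split /=; congr (_ + _).
by apply: eq_bigr => i _; rewrite mulrDr.
Qed.

Lemma deg_ltZ k a f : deg_lt k f -> deg_lt k (fun u => a * f u).
Proof.
elim: k f => [|k IHk] f /=; first by move=> f0 u Su; rewrite f0 ?mulr0.
move=> [p [c [pk fE]]].
exists (fun i u => a * p i u), (a * c); split=> [i|u Su]; first exact: IHk.
rewrite fE // mulrDr mulr_sumr; congr (_ + _).
by apply: eq_bigr => i _; rewrite mulrCA.
Qed.

Lemma deg_lt0 k : deg_lt k (fun=> 0).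
Proof.
elim: k => [//|k IHk]; exists (fun _ _ => 0), 0; split=> // u _.
by rewrite addr0 big1 // => i _; rewrite mulr0.
Qed.

Lemma deg_ltC k c : deg_lt k.+1 (fun=> c).
Proof.
exists (fun _ _ => 0), c; split=> [i|u _]; first exact: deg_lt0.
by rewrite big1 ?add0r // => i _; rewrite mulr0.
Qed.

Lemma deg_ltB k f g : deg_lt k f -> deg_lt k g -> deg_lt k (fun u => f u - g u).
Proof.
move=> fk gk; have := deg_ltD fk (deg_ltZ (-1) gk).
by move/deg_lt_ext; apply=> u _; rewrite mulN1r.
Qed.

Lemma deg_lt_sum k (I : Type) (r : seq I) (P : pred I) (F : I -> 'rV[R]_3 -> K) :
  (forall i, P i -> deg_lt k (F i)) ->
  deg_lt k (fun u => \sum_(i <- r | P i) F i u).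
Proof.
move=> Fk; elim: r => [|i r IHr].
  by apply: deg_lt_ext (deg_lt0 k) _ => u _; rewrite big_nil.
case: (boolP (P i)) => Pi.
  by apply: deg_lt_ext (deg_ltD (Fk _ Pi) IHr) _ => u _; rewrite big_cons Pi.
by apply: deg_lt_ext IHr _ => u _; rewrite big_cons (negPf Pi).
Qed.

Lemma deg_ltS k f : deg_lt k f -> deg_lt k.+1 f.
Proof.
elim: k f => [|k IHk] f.
  by move=> f0; apply: deg_lt_ext (deg_lt0 _) _ => u Su; rewrite f0.
move=> [p [c [pk fE]]]; exists p, c; split=> [i|//]; exact/IHk/pk.
Qed.

Lemma deg_ltW k l f : (k <= l)%N -> deg_lt k f -> deg_lt l f.
Proof. move=> kl fk; rewrite -(subnK kl); elim: (l - k)%N => [|n IHn] //.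
exact: deg_ltS. Qed.

Lemma deg_lt_linear k X f :
  linear_form X -> deg_lt k f -> deg_lt k.+1 (fun u => X u * f u).
Proof.
move=> [a XE] fk; exists (fun i u => a i * f u), 0; split=> [i|u Su].
  exact: deg_ltZ.
rewrite addr0 XE mulr_suml; apply: eq_bigr => i _.
by rewrite mulrCA mulrA.
Qed.

Lemma deg_lt_linearX k n X f :
  linear_form X -> deg_lt k f -> deg_lt (n + k) (fun u => X u ^+ n * f u).
Proof.
move=> Xlin fk; elim: n => [|n IHn].
  by apply: deg_lt_ext fk _ => u _; rewrite expr0 mul1r.
apply: deg_lt_ext (deg_lt_linear Xlin IHn) _ => u _.
by rewrite mulrA -exprS.
Qed.

Lemma linear_formN X : linear_form X -> linear_form (fun u => - X u).
Proof.
move=> [a XE]; exists (fun i => - a i) => u; rewrite XE raddf_sum.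
by apply: eq_bigr => i _; rewrite mulNr.
Qed.

Lemma linear_formD X Y :
  linear_form X -> linear_form Y -> linear_form (fun u => X u + Y u).
Proof.
move=> [a XE] [b YE]; exists (fun i => a i + b i) => u; rewrite XE YE -big_split.
by apply: eq_bigr => i _; rewrite mulrDl.
Qed.

Lemma linear_formZ c X : linear_form X -> linear_form (fun u => c * X u).
Proof.
move=> [a XE]; exists (fun i => c * a i) => u; rewrite XE mulr_sumr.
by apply: eq_bigr => i _; rewrite mulrA.
Qed.

Lemma linear_form_coord i : linear_form (fun u => io (u 0 i)).
Proof.
exists (fun j => (j == i)%:R) => u; rewrite (bigD1 i) //= eqxx mul1r big1 ?addr0 //.
by move=> j /negPf ->; rewrite mul0r.
Qed.

Section Parametrisation.
Variables (X Y Z : 'rV[R]_3 -> K) (e : K).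
Hypotheses (X_lin : linear_form X) (Y_lin : linear_form Y) (Z_lin : linear_form Z).
Hypothesis XYZ : forall u, S u -> X u * Y u + Z u ^+ 2 = e.
Hypothesis coordE : forall i : 'I_3, exists a b c : K,
  forall u : 'rV[R]_3, io (u 0 i) = a * X u + b * Z u - c * Y u.

(** Since [X * Y + Z ^+ 2] is constant on [S], these monomials generate the
    polynomial functions of degree [k] modulo those of lower degree.  The [j]-th
    one restricts to [t ^+ j] along the conic [(X, Y, Z) = (1, - t ^+ 2, t)]. *)
Definition conic_monomial k j (u : 'rV[R]_3) : K :=
  if (j <= k)%N then X u ^+ (k - j) * Z u ^+ j
  else (- Y u) ^+ (j - k) * Z u ^+ (2 * k - j).

(** A function of degree at most [k] whose leading part restricts to [p] along the
    conic, when the degree of [p] is at most [2 * k]. *)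
Definition conic_lift k (p : {poly K}) (u : 'rV[R]_3) : K :=
  \sum_(j < (2 * k).+1) p`_j * conic_monomial k j u.

Lemma deg_lt_monomial a b c : deg_lt (a + (b + c)).+1
  (fun u => X u ^+ a * ((- Y u) ^+ b * Z u ^+ c)).
Proof.
rewrite -!addnS; apply: deg_lt_linearX => //.
apply: deg_lt_linearX; first exact: linear_formN.
rewrite -addn1; apply: deg_lt_ext (deg_lt_linearX c Z_lin (deg_ltC 0 1)) _.
by move=> u _; rewrite mulr1.
Qed.

Lemma monomial_mulZ k j u : (j <= 2 * k)%N ->
  Z u * conic_monomial k j u = conic_monomial k.+1 j.+1 u.
Proof.
move=> jk; rewrite /conic_monomial ltnS; case: leqP => _.
  by rewrite subSS exprS; ring.
have -> : (2 * k.+1 - j.+1 = (2 * k - j).+1)%N by lia.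
by rewrite subSS exprS; ring.
Qed.

Lemma monomial_mulX k j : (j <= 2 * k)%N -> deg_lt k.+1
  (fun u => X u * conic_monomial k j u - conic_monomial k.+1 j u).
Proof.
move=> jk; rewrite /conic_monomial; have [lejk|ltkj] := leqP j k.
  apply: deg_lt_ext (deg_lt0 _) _ => u _.
  by rewrite leqW // subSn // exprS; ring.
have [b jE] : exists b, j = (k + b.+1)%N by exists (j - k).-1; lia.
have bk : (b < k)%N by lia.
have eE : (0 + (b + (k - b.+1)) = k.-1)%N by lia.
(* One factor [X * Y] is replaced by [e - Z ^+ 2]; the term in [e] has degree
   [k.-1]. *)
have := deg_lt_monomial 0 b (k - b.+1); rewrite eE prednK; last by lia.
move=> /(deg_ltZ (- e)) /(deg_ltW (leqnSn k)) /deg_lt_ext; apply=> u Su.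
rewrite -(XYZ Su) jE addKn.
have -> : (2 * k - (k + b.+1) = k - b.+1)%N by lia.
have -> : (2 * k.+1 - (k + b.+1) = (k - b.+1).+2)%N by lia.
case: ifP => le1.
  have -> : b = 0 by lia.
  have -> : (k + 1 = k - 1 + 2)%N by lia.
  have -> : (k.+1 - (k - 1 + 2) = 0)%N by lia.
  by rewrite exprD !expr0 expr1; ring.
have [c ->] : exists c, b = c.+1 by exists b.-1; lia.
have -> : (k + c.+2 - k.+1 = c.+1)%N by lia.
by rewrite !exprS; ring.
Qed.

Lemma monomial_mulY k j : (j <= 2 * k)%N -> deg_lt k.+1
  (fun u => - Y u * conic_monomial k j u - conic_monomial k.+1 j.+2 u).
Proof.
move=> jk; rewrite /conic_monomial; have [lejk|ltkj] := leqP j k; last first.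
  apply: deg_lt_ext (deg_lt0 _) _ => u _.
  rewrite ifF; last by lia.
  have -> : (j.+2 - k.+1 = (j - k).+1)%N by lia.
  have -> : (2 * k.+1 - j.+2 = 2 * k - j)%N by lia.
  by rewrite exprS; ring.
have [kj|jltk] : k = j \/ (j < k)%N by lia.
  apply: deg_lt_ext (deg_lt0 _) _ => u _.
  rewrite ifF; last by lia.
  have -> : (j.+2 - k.+1 = 1)%N by lia.
  have -> : (2 * k.+1 - j.+2 = j)%N by lia.
  by rewrite kj subnn expr0 expr1; ring.
have [a kE] : exists a, k = (j + a.+1)%N by exists (k - j).-1; lia.
have := deg_lt_monomial a 0 j => /(deg_ltZ (- e)).
have aE : ((a + (0 + j)).+1 <= k.+1)%N by lia.
move=> /(deg_ltW aE) /deg_lt_ext; apply=> u Su.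
rewrite -(XYZ Su) ifT; last by lia.
have -> : (k - j = a.+1)%N by lia.
have -> : (k.+1 - j.+2 = a)%N by lia.
by rewrite !exprS expr0; ring.
Qed.

Lemma conic_liftD k p q u :
  conic_lift k (p + q) u = conic_lift k p u + conic_lift k q u.
Proof.
rewrite -big_split; apply: eq_bigr => j _.
by rewrite coefD mulrDl.
Qed.

Lemma conic_liftZ k c p u : conic_lift k (c *: p) u = c * conic_lift k p u.
Proof.
by rewrite mulr_sumr; apply: eq_bigr => j _; rewrite coefZ mulrA.
Qed.

Lemma conic_lift_shift k s (p : {poly K}) u :
  (s <= 2)%N -> (size p <= (2 * k).+1)%N ->
  conic_lift k.+1 ('X^s * p) u =
  \sum_(j < (2 * k).+1) p`_j * conic_monomial k.+1 (j + s) u.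
Proof.
move=> s2 sp; rewrite /conic_lift.
rewrite -[LHS](big_mkord xpredT
  (fun j => ('X^s * p)`_j * conic_monomial k.+1 j u)).
rewrite (@big_cat_nat _ _ _ s) /=; try lia.
rewrite big_nat_cond big1 ?add0r; last first.
  by move=> j /andP[/andP[_ js] _]; rewrite coefXnM js mul0r.
rewrite -{1}[s]add0n big_addn (@big_cat_nat _ _ _ (2 * k).+1) /=; try lia.
rewrite [X in _ + X]big_nat_cond [X in _ + X]big1 ?addr0; last first.
  move=> j /andP[/andP[kj _] _]; rewrite coefXnM ltnNge leq_addl /= addnK.
  by rewrite nth_default ?mul0r // (leq_trans sp).
rewrite big_mkord; apply: eq_bigr => j _.
by rewrite coefXnM ltnNge leq_addl /= addnK.
Qed.

Lemma poly_size3 (q : {poly K}) : (size q <= 3)%N ->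
  q = q`_0 *: 'X^0 + q`_1 *: 'X^1 + q`_2 *: 'X^2.
Proof.
move=> q3; apply/polyP=> i; rewrite !coefD !coefZ !coefXn.
case: i => [|[|[|i]]] /=; rewrite ?mulr0 ?mulr1 ?addr0 ?add0r //.
by rewrite nth_default // (leq_trans q3).
Qed.

(** Multiplication by a quadratic polynomial in [t] lifts to multiplication by a
    linear form, up to terms of lower degree. *)
Lemma conic_liftM k (p q : {poly K}) :
  (size p <= (2 * k).+1)%N -> (size q <= 3)%N -> deg_lt k.+1 (fun u =>
    (q`_0 * X u + q`_1 * Z u - q`_2 * Y u) * conic_lift k p u
    - conic_lift k.+1 (q * p) u).
Proof.
move=> sp sq.
pose M j u := q`_0 * (X u * conic_monomial k j u - conic_monomial k.+1 j u) +
  q`_2 * (- Y u * conic_monomial k j u - conic_monomial k.+1 j.+2 u).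
have /deg_lt_ext : deg_lt k.+1 (fun u => \sum_(j < (2 * k).+1) p`_j * M j u).
  apply: deg_lt_sum => j _; apply/deg_ltZ/deg_ltD; apply: deg_ltZ.
    by apply: monomial_mulX; rewrite -ltnS.
  by apply: monomial_mulY; rewrite -ltnS.
apply=> u Su; rewrite {4}(poly_size3 sq) !mulrDl -!scalerAl.
rewrite !conic_liftD !conic_liftZ.
rewrite !conic_lift_shift // /conic_lift !mulr_sumr -!big_split /=.
rewrite -sumrN -!big_split /=.
apply: eq_bigr => j _; have jk : (j <= 2 * k)%N by rewrite -ltnS.
rewrite addn0 addn1 addn2 -(monomial_mulZ u jk) /M.
move: (conic_monomial k j u) (conic_monomial _ _ u) (conic_monomial _ _ u).
by move=> a b c; ring.
Qed.

(** Modulo lower degree, every polynomial function is determined by its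
    restriction to the conic. *)
Lemma conic_lift_surjective k f : deg_lt k.+1 f ->
  exists2 p : {poly K}, (size p <= (2 * k).+1)%N &
    deg_lt k (fun u => f u - conic_lift k p u).
Proof.
elim: k f => [|k IHk] f [g [c [gk fE]]].
  exists c%:P; first by rewrite size_polyC; case: eqP.
  move=> u Su; rewrite fE // /conic_lift muln0 big_ord1 coefC /=.
  rewrite /conic_monomial /= !expr0 big1; first by ring.
  by move=> i _; rewrite gk ?mulr0.
have {}gk i : exists p : {poly K}, (size p <= (2 * k).+1)%N /\
    deg_lt k (fun u => g i u - conic_lift k p u).
  by have [p] := IHk _ (gk i); exists p.
have [p pP] := choice gk.
have qP i : exists q : {poly K}, (size q <= 3)%N /\
    forall u : 'rV[R]_3, io (u 0 i) = q`_0 * X u + q`_1 * Z u - q`_2 * Y u.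
  have [a [b [d uE]]] := coordE i.
  by exists (Poly [:: a; b; d]); rewrite size_Poly !coef_Poly.
have [q {}qP] := choice qP.
exists (\sum_i q i * p i).
  apply: leq_trans (size_sum _ _ _) _; apply/bigmax_leqP => i _.
  apply: leq_trans (size_polyMleq _ _) _.
  by have [? _] := pP i; have [? _] := qP i; lia.
have lift_sum u : conic_lift k.+1 (\sum_i q i * p i) u =
    \sum_i conic_lift k.+1 (q i * p i) u.
  rewrite /conic_lift exchange_big /=; apply: eq_bigr => j _.
  by rewrite coef_sum mulr_suml.
pose D i (u : 'rV[R]_3) := io (u 0 i) * (g i u - conic_lift k (p i) u) +
  ((q i)`_0 * X u + (q i)`_1 * Z u - (q i)`_2 * Y u) * conic_lift k (p i) u
    - conic_lift k.+1 (q i * p i) u.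
have /deg_lt_ext : deg_lt k.+1 (fun u => \sum_i D i u + c).
  apply: deg_ltD; last exact: deg_ltC.
  apply: deg_lt_sum => i _.
  have := deg_ltD (deg_lt_linear (linear_form_coord i) (pP i).2)
    (conic_liftM (pP i).1 (qP i).1).
  by move/deg_lt_ext; apply=> u _; rewrite addrA.
apply=> u Su; rewrite fE // lift_sum addrAC -sumrB; congr (_ + _).
apply: eq_bigr => i _; rewrite /D -(qP i).2; ring.
Qed.

End Parametrisation.

End DegreeFiltration.

(** * Factorisation over the reals: the indefinite case *)

(** A factorisation of [p] into [k] quadratic polynomials lifts to a product of [k]
    linear forms. *)
Lemma conic_lift_prod (R : realType) (K : comNzRingType)
    (io : {rmorphism R -> K})
    (S : 'rV[R]_3 -> Prop) (X Y Z : 'rV[R]_3 -> K) (e : K) :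
  linear_form io X -> linear_form io Y -> linear_form io Z ->
  (forall u, S u -> X u * Y u + Z u ^+ 2 = e) ->
  forall k (q : 'I_k -> {poly K}), (forall j, size (q j) <= 3)%N ->
  (size (\prod_j q j)%R <= (2 * k).+1)%N /\ deg_lt io S k (fun u =>
    \prod_j ((q j)`_0 * X u + (q j)`_1 * Z u - (q j)`_2 * Y u)
    - conic_lift X Y Z k (\prod_j q j) u).
Proof.
move=> Xl Yl Zl XYZ; elim=> [|k IHk] q sq.
  rewrite big_ord0 size_poly1; split=> // u _; rewrite !big_ord0 /conic_lift big_ord1.
  by rewrite coef1 /conic_monomial /= !expr0 !mulr1 subrr.
have [/= sp pP] := IHk (fun j => q (lift ord0 j)) (fun j => sq _).
rewrite big_ord_recl; split.
  have := size_polyMleq (q ord0) (\prod_(j < k) q (lift ord0 j)).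
  have := sq ord0; move: sp; set p1 := (\prod_(j < k) _); rewrite /= -/p1; lia.
have l0 : linear_form io (fun u =>
    (q ord0)`_0 * X u + (q ord0)`_1 * Z u + - (q ord0)`_2 * Y u).
  by apply: linear_formD; [apply: linear_formD|]; apply: linear_formZ.
have := deg_ltD (deg_lt_linear l0 pP) (conic_liftM Xl Yl Zl XYZ sp (sq ord0)).
move/deg_lt_ext; apply=> u _; rewrite big_ord_recl.
move: (conic_lift _ _ _ _ _ _) (conic_lift _ _ _ _ _ _) (\prod_(j < k) _) => a b c.
ring.
Qed.

Lemma complex_eq (R : rcfType) (x y : R[i]) :
  complex.Re x = complex.Re y -> complex.Im x = complex.Im y -> x = y.
Proof. by case: x y => a b [c d] /= -> ->. Qed.

Section RealFactorisation.
Variable R : rcfType.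
Implicit Types p q : {poly R}.

(** A non-real root comes with its conjugate. *)
Lemma real_quadratic_dvd p : (1 < size p)%N ->
  exists2 q : {poly R}, q %| p & (1 < size q <= 3)%N.
Proof.
move=> p1; have /closed_rootP[z pz] : size (map_poly (real_complex R) p) != 1.
  by rewrite size_map_poly neq_ltn p1 orbT.
have [z_real|z_nreal] := eqVneq (complex.Im z) 0.
  exists ('X - (complex.Re z)%:P); last by rewrite size_XsubC.
  move: pz; rewrite dvdp_XsubCl [z]complexE z_real rmorph0 mulr0 addr0.
  by rewrite fmorph_root.
pose q : {poly R} :=
  'X^2 - (2 * complex.Re z) *: 'X + (complex.Re z ^+ 2 + complex.Im z ^+ 2)%:P.
have qE : map_poly (real_complex R) q = ('X - z%:P) * ('X - (conjc z)%:P).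
  have zz : (complex.Re z ^+ 2 + complex.Im z ^+ 2)%:C = z * conjc z.
    by case: (z) => a b; apply: complex_eq => /=; ring.
  have zD : (2 * complex.Re z)%:C = z + conjc z.
    by case: (z) => a b; apply: complex_eq => /=; ring.
  rewrite rmorphD rmorphB /= map_polyXn map_polyZ map_polyX map_polyC /= zz zD.
  by rewrite -mul_polyC polyCM polyCD; ring.
exists q; last first.
  have := size_map_poly (real_complex R) q; rewrite qE => <-.
  by rewrite size_mul ?polyXsubC_eq0 // !size_XsubC.
rewrite -(dvdp_map (real_complex R)) qE.
have := @uniq_roots_dvdp _ (map_poly (real_complex R) p) [:: z; conjc z].
rewrite !big_cons big_nil mulr1; apply.
  rewrite /= pz andbT /=.
  have -> : map_poly (real_complex R) p = map_poly conjc (map_poly (real_complex R) p).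
    by apply/polyP => i; rewrite !coef_map /= oppr0.
  by rewrite complex_root_conj conjcK.
rewrite uniq_rootsE /= !inE andbT; apply/negP => /eqP zz.
case/eqP: z_nreal; move: zz; case: z {pz q qE} => a b [] /= /eqP.
by rewrite -addr_eq0 -mulr2n mulrn_eq0 /= => /eqP.
Qed.

Lemma real_quadratic_factor k p : (size p <= (2 * k.+1).+1)%N ->
  exists q g, [/\ p = q * g, (size q <= 3)%N & (size g <= (2 * k).+1)%N].
Proof.
move=> sp; have [p1|p1] := leqP (size p) 1.
  by exists 1, p; rewrite mul1r size_poly1; split=> //; lia.
have p0 : p != 0 by rewrite -size_poly_gt0; lia.
have [q /dvdpP[g pE] sq] := real_quadratic_dvd p1.
have [g0 q0] : g != 0 /\ q != 0.
  by apply/andP; rewrite -negb_or -mulf_eq0 -pE.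
have sgq : size p = (size g + size q).-1 by rewrite pE size_mul.
have gpos : (0 < size g)%N by rewrite size_poly_gt0.
have [sg|sg] := leqP (size g) (2 * k).+1.
  by exists q, g; rewrite mulrC; split=> //; case/andP: sq.
(* A linear factor [q] leaves a cofactor [g] of degree [2 * k + 1], from which a
   further factor is taken. *)
have [q1 /dvdpP[h gE] sq1] : exists2 q1 : {poly R}, q1 %| g & (1 < size q1 <= 3)%N.
  by apply: real_quadratic_dvd; apply: leq_trans sg.
have [h0 q10] : h != 0 /\ q1 != 0.
  by apply/andP; rewrite -negb_or -mulf_eq0 -gE.
have sgq1 : size g = (size h + size q1).-1 by rewrite gE size_mul.
have sq2 : size q = 2.
  by move: sp sg sgq sq; move: (size p) (size g) (size q) => a b c; lia.
have [e2|e3] : size q1 = 2 \/ size q1 = 3 by lia.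
- exists (q * q1), h; rewrite size_mul // sq2 e2; split=> //.
    by rewrite pE gE; ring.
  move: sp; rewrite sgq sgq1 sq2 e2.
  by move: (size h) => a; lia.
- exists q1, (q * h); rewrite size_mul // sq2 e3; split=> //.
    by rewrite pE gE; ring.
  move: sp; rewrite sgq sgq1 sq2 e3.
  by move: (size h) => a; lia.
Qed.

Lemma real_quadratic_factorisation k p : (size p <= (2 * k).+1)%N ->
  exists (c : R) (q : 'I_k -> {poly R}),
    p = c *: \prod_j q j /\ forall j, (size (q j) <= 3)%N.
Proof.
elim: k p => [|k IHk] p sp.
  exists p`_0, (fun=> 0); split=> [|[]//].
  by rewrite big_ord0 alg_polyC; apply: size1_polyC.
have [q0 [g [-> sq0 sg]]] := real_quadratic_factor sp.
have [c [q [-> sq]]] := IHk g sg.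
exists c, (fun j => if unlift ord0 j is Some i then q i else q0); split=> [|j].
  rewrite big_ord_recl unlift_none -scalerAr; congr (_ *: (_ * _)).
  by apply: eq_bigr => j _; rewrite liftK.
by case: unliftP => [i|] _.
Qed.

End RealFactorisation.

(** The linear form with coefficients [v], as a function. *)
Definition dot (R : realType) (v u : 'rV[R]_3) : R := \sum_i v 0 i * u 0 i.

Lemma dotE (R : realType) (v u : 'rV[R]_3) :
  dot v u = v 0 0 * u 0 0 + v 0 1 * u 0 1 + v 0 2%:R * u 0 2%:R.
Proof.
rewrite /dot !big_ord_recr big_ord0 /= add0r.
by congr (_ * _ + _ * _ + _ * _); congr (_ 0 _); apply: val_inj.
Qed.

Lemma dotZ (R : realType) c (v u : 'rV[R]_3) : dot (c *: v) u = c * dot v u.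
Proof. by rewrite !dotE !mxE; ring. Qed.

Lemma meval_linprod (R : realType) k (v : {ffun 'I_k -> 'rV[R]_3})
    (u : 'rV[R]_3) :
  (linprod v).@[u 0] = \prod_j dot (v j) u.
Proof. by rewrite rmorph_prod; apply: eq_bigr => j _; exact: meval_linform. Qed.

(** Modulo lower degree, every polynomial function of degree at most [k.+1] is on
    [S] a product of [k.+1] real linear forms. *)
Definition leading_products (R : realType) (S : 'rV[R]_3 -> Prop) :=
  forall k f, deg_lt (@idfun R) S k.+2 f ->
  exists v : 'I_k.+1 -> 'rV[R]_3,
    deg_lt (@idfun R) S k.+1 (fun u => f u - \prod_j dot (v j) u).

Lemma leading_products_sum (R : realType) (S : 'rV[R]_3 -> Prop) d f :
  leading_products S -> deg_lt (@idfun R) S d.+1 f ->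
  exists (lam : R) (v : nat -> nat -> 'rV[R]_3), forall u, S u ->
    f u = lam + \sum_(k < d) \prod_(j < k.+1) dot (v k j) u.
Proof.
move=> lead; elim: d f => [|d IHd] f fd.
  have [g [c [g0 fE]]] := fd; exists c, (fun _ _ => 0) => u Su.
  by rewrite fE // big_ord0 addr0 big1 ?add0r // => i _; rewrite g0 ?mulr0.
have [w /IHd[lam [v vE]]] := lead _ _ fd.
exists lam, (fun k j => if k == d then w (inord j) else v k j) => u Su.
rewrite big_ord_recr /= addrA -[f u](subrK (\prod_j dot (w j) u)) vE //.
congr (_ + _ + _).
  by apply: eq_bigr => k _; rewrite ltn_eqF.
by apply: eq_bigr => j _; rewrite eqxx inord_val.
Qed.

Lemma scale_prod_dot (R : realType) k c (v : 'I_k.+1 -> 'rV[R]_3) :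
  exists w : 'I_k.+1 -> 'rV[R]_3, forall u,
    \prod_j dot (w j) u = c * \prod_j dot (v j) u.
Proof.
exists (fun j => if j == ord0 then c *: v j else v j) => u.
by rewrite !big_ord_recl eqxx dotZ mulrA.
Qed.

(** The conic of an indefinite form is parametrised over the reals. *)
Lemma indefinite_leading_products (R : realType) (e : R) : e ^+ 2 = 1 ->
  leading_products (fun u : 'rV[R]_3 => e * (u 0 0 * u 0 1 + u 0 2%:R ^+ 2) = 1).
Proof.
set S := (fun u : 'rV[R]_3 => _) => e2 k f fk.
pose X (u : 'rV[R]_3) := u 0 0; pose Y (u : 'rV[R]_3) := u 0 1.
pose Z (u : 'rV[R]_3) := u 0 2%:R.
have Xl : linear_form idfun X := linear_form_coord _ _.
have Yl : linear_form idfun Y := linear_form_coord _ _.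
have Zl : linear_form idfun Z := linear_form_coord _ _.
have XYZ u : S u -> X u * Y u + Z u ^+ 2 = e.
  by move=> Su; rewrite -[LHS]mul1r -e2 expr2 -mulrA Su mulr1.
have coordE (i : 'I_3) : exists a b c : R,
    forall u : 'rV[R]_3, idfun (u 0 i) = a * X u + b * Z u - c * Y u.
  case: i => [[|[|[|//]]] hi].
  - exists 1, 0, 0 => u; rewrite !mul0r subr0 addr0 mul1r.
    by congr (u _ _); apply: val_inj.
  - exists 0, 0, (-1) => u; rewrite !mul0r !add0r mulN1r opprK.
    by congr (u _ _); apply: val_inj.
  - exists 0, 1, 0 => u; rewrite !mul0r subr0 add0r mul1r.
    by congr (u _ _); apply: val_inj.
have [p sp pP] := conic_lift_surjective Xl Yl Zl XYZ coordE fk.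
have [c [q [pE sq]]] := real_quadratic_factorisation sp.
have [_ qP] := conic_lift_prod Xl Yl Zl XYZ sq.
pose v j : 'rV[R]_3 := \row_i [:: (q j)`_0; - (q j)`_2; (q j)`_1]`_i.
have [w wE] := scale_prod_dot c v; exists w.
apply: deg_lt_ext (deg_ltB pP (deg_ltZ c qP)) _ => u Su.
rewrite wE pE conic_liftZ.
have -> : \prod_j dot (v j) u =
    \prod_j ((q j)`_0 * X u + (q j)`_1 * Z u - (q j)`_2 * Y u).
  apply: eq_bigr => j _; rewrite dotE !mxE /X /Y /Z /=.
  ring.
ring.
Qed.

(** * Antipodal symmetry of the conic of a definite form *)

Lemma reverse_monomial (K : fieldType) k j (t c : K) :
  t != 0 -> (j <= 2 * k)%N ->
  (-1) ^+ (k + (2 * k - j)) * c * t ^+ (2 * k - j) =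
  (-1) ^+ k * t ^+ (2 * k) * (c * (- t^-1) ^+ j).
Proof.
move=> t0 jk; have -> : (-1) ^+ (k + (2 * k - j)) = (-1) ^+ k * (-1) ^+ j :> K.
  by rewrite exprD -[in X in _ * X]signr_odd oddB // oddM /= signr_odd.
have -> : t ^+ (2 * k) = t ^+ (2 * k - j) * t ^+ j by rewrite -exprD subnK.
have tj : t ^+ j != 0 by rewrite expf_neq0.
by rewrite [(- t^-1) ^+ j]exprNn exprVn; field.
Qed.

Section Antipodal.
Variable R : realType.
Local Notation C := R[i].
Local Notation toC := (real_complex R).
Implicit Types (p q : {poly C}) (v : 'rV[R]_3).

(** Complex conjugation acts on the conic [x^2 + y^2 + z^2 = 0] as the antipodal
    map [t |-> - 1 / conj t] of the parameter.  This is the induced involution on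
    polynomials of degree at most [2 * k], the restrictions of forms of degree [k];
    restrictions of real forms are fixed. *)
Definition star k p : {poly C} :=
  \poly_(j < (2 * k).+1) ((-1) ^+ (k + j) * conjc p`_(2 * k - j)).

Lemma size_star k p : (size (star k p) <= (2 * k).+1)%N.
Proof. exact: size_poly. Qed.

Lemma coef_star k p j : (j <= 2 * k)%N ->
  (star k p)`_j = (-1) ^+ (k + j) * conjc p`_(2 * k - j).
Proof. by move=> jk; rewrite coef_poly ltnS jk. Qed.

Lemma conj_sign n : conjc ((-1) ^+ n : C) = (-1) ^+ n.
Proof. by rewrite rmorphXn rmorphN1. Qed.

Lemma starK k p : (size p <= (2 * k).+1)%N -> star k (star k p) = p.
Proof.
move=> sp; apply/polyP => j; have [jk|kj] := leqP j (2 * k); last first.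
  by rewrite !nth_default // (leq_trans _ kj) ?size_star.
rewrite coef_star // coef_star ?leq_subr // subKn // rmorphM /= conj_sign conjcK.
rewrite mulrA -exprD (_ : (k + j + (k + (2 * k - j)) = 2 * (2 * k))%N); last by lia.
by rewrite exprM sqrrN expr1n expr1n mul1r.
Qed.

Lemma starD k p q : star k (p + q) = star k p + star k q.
Proof.
apply/polyP => j; rewrite coefD !coef_poly; case: ifP => _; last by rewrite addr0.
by rewrite coefD rmorphD mulrDr.
Qed.

Lemma starZ k (a : C) p : star k (a *: p) = conjc a *: star k p.
Proof.
apply/polyP => j; rewrite coefZ !coef_poly; case: ifP => _; last by rewrite mulr0.
by rewrite coefZ rmorphM mulrCA.
Qed.

Lemma horner_star k p (t : C) : (size p <= (2 * k).+1)%N -> t != 0 ->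
  (star k p).[t] = (-1) ^+ k * t ^+ (2 * k) * conjc (p.[- (conjc t)^-1]).
Proof.
move=> sp t0; rewrite horner_poly (horner_coef_wide _ sp) rmorph_sum mulr_sumr /=.
rewrite (reindex_inj rev_ord_inj) /=; apply: eq_bigr => j _.
have jk : (j <= 2 * k)%N by rewrite -ltnS.
rewrite subSS subKn // rmorphM rmorphXn rmorphN fmorphV /= conjcK.
exact: reverse_monomial.
Qed.

(** The restriction of the linear form with coefficients [v] to the conic
    [x^2 + y^2 + z^2 = 0], parametrised by [x + iy = 1], [x - iy = - t^2],
    [z = t]. *)
Definition null_poly v : {poly C} :=
  let w : C := (v 0 0 / 2 -i* (v 0 1 / 2))%C in
  w%:P + toC (v 0 2%:R) *: 'X - conjc w *: 'X^2.

Lemma coef_null_poly v :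
  [/\ (null_poly v)`_0 = (v 0 0 / 2 -i* (v 0 1 / 2))%C,
      (null_poly v)`_1 = toC (v 0 2%:R)
    & (null_poly v)`_2 = - (v 0 0 / 2 +i* (v 0 1 / 2))%C].
Proof.
by split; rewrite /null_poly !coefB !coefD !coefZ !coefXn coefX coefC /=
  ?(mulr0, mulr1, addr0, subr0, add0r, sub0r, opprK).
Qed.

Lemma size_null_poly v : (size (null_poly v) <= 3)%N.
Proof.
apply/leq_sizeP => -[|[|[|j]]] // _.
rewrite /null_poly !coefB !coefD !coefZ !coefXn coefX coefC /=.
by rewrite !mulr0 !addr0 subr0.
Qed.

Lemma star_null_poly v : star 1 (null_poly v) = null_poly v.
Proof.
have [e0 e1 e2] := coef_null_poly v.
apply/polyP => -[|[|[|j]]].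
- by rewrite coef_star // e0 e2 expr1 mulN1r rmorphN opprK.
- by rewrite coef_star // e1 sqrrN expr1n mul1r /= oppr0.
- by rewrite coef_star // e0 e2 exprS sqrrN expr1n mulr1 mulN1r /= opprK.
- rewrite !nth_default // ?(leq_trans (size_star _ _)) //.
  exact: leq_trans (size_null_poly _) _.
Qed.

(** The real linear form vanishing at the point of parameter [a], hence at its
    antipode. *)
Definition null_vector (a : C) : 'rV[R]_3 :=
  \row_i [:: - 2 * complex.Re a; 2 * complex.Im a;
             1 - (complex.Re a ^+ 2 + complex.Im a ^+ 2)]`_i.

Lemma null_poly_vector a :
  null_poly (null_vector a) = ('X - a%:P) * ((conjc a) *: 'X + 1).
Proof.
have [e0 e1 e2] := coef_null_poly (null_vector a).
rewrite [LHS](poly_size3 (size_null_poly _)) e0 e1 e2 !mxE /= expr0 expr1.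
have -> : (- 2 * complex.Re a / 2 -i* (2 * complex.Im a / 2))%C = - a.
  by case: a {e0 e1 e2} => x y; apply: complex_eq => /=; field.
have -> : (- 2 * complex.Re a / 2 +i* (2 * complex.Im a / 2))%C = - conjc a.
  by case: a {e0 e1 e2} => x y; apply: complex_eq => /=; field.
have -> : (1 - (complex.Re a ^+ 2 + complex.Im a ^+ 2))%:C%C = 1 - a * conjc a.
  by case: a {e0 e1 e2} => x y; apply: complex_eq => /=; ring.
rewrite -!mul_polyC !polyCN polyCB polyCM polyC1; ring.
Qed.

End Antipodal.

(** * Factorisation into antipodal factors *)

Section NullFactorisation.
Variable R : realType.
Local Notation C := R[i].
Local Notation toC := (real_complex R).
Implicit Types (p q : {poly C}) (v : 'rV[R]_3).

Lemma rowP3 v v' :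
  v 0 0 = v' 0 0 -> v 0 1 = v' 0 1 -> v 0 2%:R = v' 0 2%:R -> v = v'.
Proof.
move=> e0 e1 e2; apply/rowP => -[[|[|[|//]]] hi].
- by rewrite (_ : Ordinal hi = 0) //; apply: val_inj.
- by rewrite (_ : Ordinal hi = 1) //; apply: val_inj.
- by rewrite (_ : Ordinal hi = 2%:R) //; apply: val_inj.
Qed.

Lemma null_polyZ c v : null_poly (c *: v) = toC c *: null_poly v.
Proof.
have [e0 e1 e2] := coef_null_poly v; have [f0 f1 f2] := coef_null_poly (c *: v).
rewrite [LHS](poly_size3 (size_null_poly _)).
rewrite [in RHS](poly_size3 (size_null_poly _)).
rewrite e0 e1 e2 f0 f1 f2 !scalerDr !scalerA !mxE.
by congr (_ *: _ + _ *: _ + _ *: _); apply: complex_eq => /=; ring.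
Qed.

Lemma null_poly_eq0 v : null_poly v = 0 -> v = 0.
Proof.
move=> q0; have [_ e1 e2] := coef_null_poly v.
move: e1 e2; rewrite q0 !coef0 => -[z0] [/eqP x0 /eqP y0].
by apply: rowP3; rewrite mxE //; [move: x0|move: y0];
  rewrite eq_sym oppr_eq0 mulf_eq0 invr_eq0 pnatr_eq0 orbF => /eqP.
Qed.

Lemma null_poly_root_exists v : v != 0 -> exists a, root (null_poly v) a.
Proof.
move=> v0; apply/closed_rootP; apply: contraNneq v0 => s1; apply/eqP.
have [_ e1 e2] := coef_null_poly v.
have : [/\ (null_poly v)`_1 = 0 & (null_poly v)`_2 = 0].
  by rewrite !nth_default ?s1.
rewrite e1 e2 => -[[c0] [/eqP a0 /eqP b0]].
by apply: rowP3; rewrite mxE //; [move: a0|move: b0];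
  rewrite oppr_eq0 mulf_eq0 invr_eq0 pnatr_eq0 orbF => /eqP.
Qed.

Lemma root_null_poly v a : root (null_poly v) a ->
  exists r : R, v = r *: null_vector a.
Proof.
rewrite /root /null_poly !(hornerE, horner_exp).
case: a => p q; rewrite eq_complex /= => /andP[/eqP E1 /eqP E2].
set x := v 0 0 in E1 E2; set y := v 0 1 in E1 E2; set z := v 0 2%:R in E1 E2.
have n0 : 1 + p ^+ 2 + q ^+ 2 != 0.
  by rewrite gt_eqF // -addrA ltr_wpDr // addr_ge0 ?sqr_ge0.
have {}E1 : x / 2 + z * p - (x * (p ^+ 2 - q ^+ 2) - 2 * y * p * q) / 2 = 0.
  by rewrite -[RHS]E1; ring.
have {}E2 : - y / 2 + z * q - (y * (p ^+ 2 - q ^+ 2) + 2 * x * p * q) / 2 = 0.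
  by rewrite -[RHS]E2; ring.
exists ((- 2 * p * x + 2 * q * y + (1 - (p ^+ 2 + q ^+ 2)) * z) /
  (1 + p ^+ 2 + q ^+ 2) ^+ 2).
(* The equations [E1] and [E2] say that [v] is orthogonal to the real and to the
   imaginary part of the point of parameter [p + i q]; these are orthogonal
   vectors of equal length, and the projection of [v] on them vanishes. *)
apply: rowP3; rewrite !mxE /= -/x -/y -/z; apply/eqP; rewrite -subr_eq0; apply/eqP.
- transitivity (4 * (0 * ((1 - p ^+ 2 + q ^+ 2) / 2) - 0 * (p * q)) /
      (1 + p ^+ 2 + q ^+ 2) ^+ 2).
    by rewrite -{1}E1 -E2; field.
  by rewrite !mul0r subrr mulr0 mul0r.
- transitivity (4 * (0 * (p * q) - 0 * ((1 + p ^+ 2 - q ^+ 2) / 2)) /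
      (1 + p ^+ 2 + q ^+ 2) ^+ 2).
    by rewrite -{1}E1 -E2; field.
  by rewrite !mul0r subrr mulr0 mul0r.
- transitivity (4 * (0 * p + 0 * q) /
      (1 + p ^+ 2 + q ^+ 2) ^+ 2).
    by rewrite -{1}E1 -E2; field.
  by rewrite !mul0r addr0 mulr0 mul0r.
Qed.

(** Roots come in antipodal pairs, each of which determines its factor up to a
    real constant: the factorisation into such quadratic factors is unique. *)
Lemma null_factorisation_unique k c (v v' : 'I_k -> 'rV[R]_3) :
  (forall j, v j != 0) -> (forall j, v' j != 0) ->
  toC c *: \prod_j null_poly (v j) = \prod_j null_poly (v' j) ->
  exists (s : 'S_k) (l : 'I_k -> R),
    \prod_j l j = c /\ forall j, v' j = l j *: v (s j).
Proof.
elim: k c v v' => [|k IHk] c v v' v0 v'0 E.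
  exists 1%g, (fun=> 1); split=> [|[]//]; rewrite big_ord0.
  move/(congr1 (fun p : {poly C} => p`_0)): E.
  by rewrite !big_ord0 coefZ coef1 mulr1 => -[].
have [a va] := null_poly_root_exists (v0 ord0).
have [m v'a] : exists m, root (null_poly (v' m)) a.
  have : root (\prod_j null_poly (v' j)) a.
    by rewrite -E /root hornerZ big_ord_recl hornerM (rootP va) mul0r mulr0.
  rewrite /root horner_prod => /eqP/eqP/prodf_eq0[m _ h]; by exists m.
have [r vr] := root_null_poly va; have [r' vr'] := root_null_poly v'a.
have r0 : r != 0 by apply: contraNneq (v0 ord0) => r0; rewrite vr r0 scale0r.
have r'0 : r' != 0 by apply: contraNneq (v'0 m) => r'0; rewrite vr' r'0 scale0r.
pose l0 := r' / r.
have l00 : l0 != 0 by rewrite mulf_neq0 ?invr_eq0.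
have v'm : v' m = l0 *: v ord0 by rewrite vr vr' scalerA divfK.
have q0 : null_poly (v ord0) != 0.
  by apply: contraNneq (v0 ord0) => /null_poly_eq0 ->.
have [] := IHk (c / l0) (fun j => v (lift ord0 j)) (fun j => v' (lift m j)) => //.
  apply: (mulfI q0); apply: (@scalerI _ _ (toC l0)).
    by rewrite fmorph_eq0.
  move: E; rewrite big_ord_recl (bigD1_ord m) //= v'm null_polyZ.
  rewrite -scalerAl => <-; rewrite -scalerAr scalerA -rmorphM.
  by rewrite mulrC divfK.
move=> s [l [lE v'E]].
exists (lift_perm m ord0 s), (fun j => if unlift m j is Some i then l i else l0).
split=> [|j].
  rewrite (bigD1_ord m) //= unlift_none -[RHS](divfK l00) mulrC; congr (_ * _).
  by rewrite -lE; apply: eq_bigr => j _; rewrite liftK.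
case: unliftP => [i|] ->; first by rewrite lift_perm_lift v'E.
by rewrite lift_perm_id.
Qed.

Lemma poly_eq_off0 p q : (forall t, t != 0 -> p.[t] = q.[t]) -> p = q.
Proof.
move=> pq; apply/eqP; rewrite -subr_eq0; apply/eqP.
have X0 : 'X != 0 :> {poly C} by rewrite polyX_eq0.
apply: (mulfI X0); rewrite mulr0.
apply: (@poly_vanishing_eq0 C C idfun) => // t.
rewrite hornerM hornerX hornerD hornerN.
by have [->|/pq ->] := eqVneq t 0; rewrite ?mul0r // subrr mulr0.
Qed.

Lemma starM k p q : (size q <= 3)%N -> (size p <= (2 * k).+1)%N ->
  star k.+1 (q * p) = star 1 q * star k p.
Proof.
move=> sq sp; apply: poly_eq_off0 => t t0; rewrite hornerM !horner_star //.
  rewrite mulnS exprD exprS hornerM rmorphM /= expr1 muln1.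
  move: (conjc _) (conjc _) ((-1) ^+ k) (t ^+ (2 * k)) (t ^+ 2) => x y z a b.
  ring.
have := size_polyMleq q p.
by move: (size (q * p)) (size q) (size p) sq sp => x y z; lia.
Qed.

(** The roots of a polynomial fixed by the antipodal involution come in antipodal
    pairs.  A root at [0] is paired with one at infinity, which shows as a drop of
    the degree. *)
Lemma star_factorisation k p : (size p <= (2 * k).+1)%N -> star k p = p ->
  exists (c : R) (v : 'I_k -> 'rV[R]_3), p = toC c *: \prod_j null_poly (v j).
Proof.
elim: k p => [|k IHk] p sp pE.
  exists (complex.Re p`_0), (fun=> 0); rewrite big_ord0 alg_polyC.
  rewrite [LHS](size1_polyC sp); congr _%:P.
  have : p`_0 = conjc p`_0 by rewrite -{1}pE coef_star // expr0 mul1r.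
  case: (p`_0) => a b [] /eqP; rewrite -addr_eq0 -mulr2n mulrn_eq0 /= => /eqP ->.
  by [].
have [->|p0] := eqVneq p 0; first by exists 0, (fun=> 0); rewrite scale0r.
have p0E : p`_0 = (-1) ^+ k.+1 * conjc p`_(2 * k.+1).
  by rewrite -{1}pE coef_star // addn0 subn0.
have /closed_rootP[a pa] : size p != 1.
  apply: contraNneq p0 => s1; have : p`_0 = 0.
    by rewrite p0E [p`_(_)]nth_default ?s1 ?rmorph0 ?mulr0 // mulnS.
  by rewrite (size1_polyC (p := p)) ?s1 // coefC /= => ->; rewrite polyC0.
have [g gE sg] : exists2 g, p = null_poly (null_vector a) * g &
    (size g <= (2 * k).+1)%N.
  rewrite null_poly_vector; have [a0|a0] := eqVneq a 0.
    move: pa; rewrite a0 conjc0 scale0r add0r mulr1 -dvdp_XsubCl => /dvdpP[g gE].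
    exists g; first by rewrite mulrC.
    have g0 : g != 0 by apply: contraNneq p0 => g0; rewrite gE g0 mul0r.
    have : (size p <= 2 * k.+1)%N.
      apply/leq_sizeP => j; rewrite leq_eqVlt => /predU1P[<-|kj]; last first.
        by rewrite nth_default // (leq_trans sp).
      have e0 : p`_0 = 0 by rewrite gE subr0 coefMX.
      move/esym/eqP: p0E; rewrite e0 mulf_eq0 signr_eq0 conjc_eq0.
      by move/eqP.
    by rewrite gE subr0 size_mulX //; lia.
  have ca0 : conjc a != 0 by rewrite conjc_eq0.
  pose b := - (conjc a)^-1.
  have pb : root p b.
    rewrite /root -pE horner_star ?oppr_eq0 ?invr_eq0 //.
    by rewrite rmorphN fmorphV /= conjcK invrN invrK opprK (rootP pa) rmorph0 mulr0.
  have ab : a != b.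
    apply/eqP => ab; have : a * conjc a = - 1 by rewrite {1}ab mulNr mulVf.
    move=> e; have := mulcJ_ge0 a; rewrite e oppr_ge0 ler10 //.
  have := @uniq_roots_dvdp _ p [:: a; b].
  rewrite uniq_rootsE /= pa pb inE ab !big_cons big_nil mulr1.
  move=> /(_ isT isT)/dvdpP[g gE]; exists ((conjc a)^-1 *: g).
    have -> : conjc a *: 'X + 1 = conjc a *: ('X - b%:P) :> {poly C}.
      rewrite scalerBr /b polyCN scalerN opprK -[_ *: _%:P]mul_polyC.
      by rewrite -polyCM mulfV.
    have cc : (conjc a)%:P * ((conjc a)^-1)%:P = 1 by rewrite -polyCM mulfV.
    rewrite gE -[LHS]mul1r -cc -!mul_polyC.
    by move: (conjc a)%:P (_^-1)%:P => y z; ring.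
  rewrite size_scale ?invr_eq0 //.
  have g0 : g != 0 by apply: contraNneq p0 => g0; rewrite gE g0 mul0r.
  move: sp; rewrite gE size_mul ?mulf_neq0 ?polyXsubC_eq0 //.
  by rewrite size_mul ?polyXsubC_eq0 // !size_XsubC; move: (size g) => n; lia.
(* The involution is multiplicative, so the cofactor is fixed as well. *)
have gS : star k g = g.
  have q0 : null_poly (null_vector a) != 0.
    by apply: contraNneq p0 => q0; rewrite gE q0 mul0r.
  apply: (mulfI q0); rewrite -[in LHS]star_null_poly -starM // ?size_null_poly //.
  by rewrite -gE.
have [c [v vE]] := IHk g sg gS.
exists c, (fun j => if unlift ord0 j is Some i then v i else null_vector a).
rewrite gE vE big_ord_recl unlift_none -scalerAr; congr (_ *: (_ * _)).
by apply: eq_bigr => j _; rewrite liftK.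
Qed.

End NullFactorisation.

(** * Leading products on the sphere *)

Section Sphere.
Variable R : realType.
Local Notation C := R[i].
Local Notation toC := (real_complex R).
Local Notation sphere := (fun u : 'rV[R]_3 => \sum_i u 0 i ^+ 2 = 1).

Lemma deg_lt_toC (S : 'rV[R]_3 -> Prop) k f :
  deg_lt idfun S k f -> deg_lt toC S k (fun u => toC (f u)).
Proof.
elim: k f => [|k IHk] f /=; first by move=> f0 u Su; rewrite f0.
move=> [g [c [gk fE]]]; exists (fun i u => toC (g i u)), (toC c).
split=> [i|u Su]; first exact: IHk.
rewrite fE // rmorphD rmorph_sum; congr (_ + _); apply: eq_bigr => i _.
by rewrite rmorphM.
Qed.

Lemma deg_lt_conj (S : 'rV[R]_3 -> Prop) k f :
  deg_lt toC S k f -> deg_lt toC S k (fun u => conjc (f u)).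
Proof.
elim: k f => [|k IHk] f /=; first by move=> f0 u Su; rewrite f0 ?rmorph0.
move=> [g [c [gk fE]]]; exists (fun i u => conjc (g i u)), (conjc c).
split=> [i|u Su]; first exact: IHk.
rewrite fE // rmorphD rmorph_sum; congr (_ + _); apply: eq_bigr => i _.
by rewrite rmorphM /= oppr0.
Qed.

Lemma Re_mulr (x : R) (z : C) : complex.Re (toC x * z) = x * complex.Re z.
Proof. by case: z => a b /=; rewrite mul0r subr0. Qed.

Lemma deg_lt_Re (S : 'rV[R]_3 -> Prop) k f :
  deg_lt toC S k f -> deg_lt idfun S k (fun u => complex.Re (f u)).
Proof.
elim: k f => [|k IHk] f /=; first by move=> f0 u Su; rewrite f0.
move=> [g [c [gk fE]]]; exists (fun i u => complex.Re (g i u)), (complex.Re c).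
split=> [i|u Su]; first exact: IHk.
have ReD (x y : C) : complex.Re (x + y) = complex.Re x + complex.Re y.
  by case: x; case: y.
rewrite fE // ReD; congr (_ + _).
rewrite !big_ord_recr !big_ord0 /= !ReD.
by rewrite !Re_mulr.
Qed.

Lemma conic_lift_star (X Y Z : 'rV[R]_3 -> C) k (p : {poly C}) u :
  conjc (X u) = Y u -> conjc (Z u) = Z u ->
  conjc (conic_lift X Y Z k p u) = conic_lift X Y Z k (star k p) u.
Proof.
move=> XY ZZ; have YX : conjc (Y u) = X u by rewrite -XY conjcK.
rewrite /conic_lift rmorph_sum (reindex_inj rev_ord_inj) /=.
apply: eq_bigr => j _; have jk : (j <= 2 * k)%N by rewrite -ltnS.
rewrite subSS rmorphM coef_star //= [in RHS]mulrAC mulrC; congr (_ * _).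
rewrite /conic_monomial; have [jltk|kltj|jk'] := ltngtP j k.
- rewrite ifF; last by lia.
  have -> : (2 * k - j - k = k - j)%N by lia.
  have -> : (2 * k - (2 * k - j) = j)%N by lia.
  rewrite rmorphM !rmorphXn rmorphN /= YX ZZ [(- X u) ^+ _]exprNn -mulrA.
  congr (_ * _).
  by rewrite -[LHS]signr_odd oddB 1?ltnW // -oddD signr_odd.
- rewrite ifT; last by lia.
  have -> : (k - (2 * k - j) = j - k)%N by lia.
  rewrite rmorphM !rmorphXn /= XY ZZ [(- Y u) ^+ _]exprNn !mulrA -exprD.
  have -> : (k + j + (j - k) = 2 * j)%N by lia.
  by rewrite exprM sqrrN !expr1n mul1r.
- rewrite jk' ifT; last by lia.
  have -> : (2 * k - k = k)%N by lia.
  by rewrite subnn !expr0 !mul1r rmorphXn /= ZZ -signr_odd addnn odd_double mul1r.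
Qed.

(** On the sphere the conic has no real point; its complex parametrisation is
    compatible with complex conjugation through the antipodal involution. *)
Lemma definite_leading_products : leading_products sphere.
Proof.
move=> k f fk.
pose X (u : 'rV[R]_3) : C := (u 0 0 +i* u 0 1)%C.
pose Y (u : 'rV[R]_3) : C := (u 0 0 -i* u 0 1)%C.
pose Z (u : 'rV[R]_3) : C := toC (u 0 2%:R).
have sum3 (V : nmodType) (F : 'I_3 -> V) : \sum_i F i = F 0 + F 1 + F 2%:R.
  by apply: ord3_sum.
have Xl : linear_form toC X.
  exists (fun i => [:: 1; 'i%C; 0]`_i) => u; rewrite sum3 /= /X.
  by apply: complex_eq => /=; ring.
have Yl : linear_form toC Y.
  exists (fun i => [:: 1; - 'i%C; 0]`_i) => u; rewrite sum3 /= /X.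
  by apply: complex_eq => /=; ring.
have Zl : linear_form toC Z by apply: linear_form_coord.
have XYZ u : sphere u -> X u * Y u + Z u ^+ 2 = 1.
  rewrite sum3 => Su; apply/eqP; rewrite eq_complex /= -Su.
  by apply/andP; split; apply/eqP; ring.
have coordE (i : 'I_3) : exists a b c : C,
    forall u : 'rV[R]_3, toC (u 0 i) = a * X u + b * Z u - c * Y u.
  case: i => [[|[|[|//]]] hi].
  - exists (toC 2^-1), 0, (- toC 2^-1) => u.
    rewrite (_ : Ordinal hi = 0); last exact: val_inj.
    by apply: complex_eq => /=; field.
  - exists (0 -i* 2^-1)%C, 0, (0 -i* 2^-1)%C => u.
    rewrite (_ : Ordinal hi = 1); last exact: val_inj.
    by apply: complex_eq => /=; field.
  - exists 0, 1, 0 => u; rewrite !mul0r subr0 add0r mul1r.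
    by congr (toC (u _ _)); apply: val_inj.
have [p sp pP] := conic_lift_surjective Xl Yl Zl XYZ coordE (deg_lt_toC fk).
(* As [f] is real, [p] may be replaced by its average with [star p]. *)
have pP' : deg_lt toC sphere k.+1
    (fun u => toC (f u) - conic_lift X Y Z k.+1 (star k.+1 p) u).
  apply: deg_lt_ext (deg_lt_conj pP) _ => u _.
  rewrite rmorphB /= oppr0; congr (_ - _).
  by apply: conic_lift_star; rewrite //= oppr0.
pose p' := toC 2^-1 *: (p + star k.+1 p).
have sp' : (size p' <= (2 * k.+1).+1)%N.
  apply: leq_trans (size_scale_leq _ _) _; apply: leq_trans (size_polyD _ _) _.
  by rewrite geq_max sp size_star.
have p'S : star k.+1 p' = p'.
  by rewrite /p' starZ starD starK // conjc_real addrC.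
have [c [v p'E]] := star_factorisation sp' p'S.
have [_ qP] := conic_lift_prod Xl Yl Zl XYZ (fun j => size_null_poly (v j)).
have [w wE] := scale_prod_dot c v; exists w.
have := deg_ltZ (toC 2^-1) (deg_ltD pP pP').
move=> /deg_ltB /(_ (deg_ltZ (toC c) qP)) /deg_lt_Re /deg_lt_ext; apply=> u Su /=.
rewrite wE.
have -> : \prod_j ((null_poly (v j))`_0 * X u + (null_poly (v j))`_1 * Z u -
    (null_poly (v j))`_2 * Y u) = toC (\prod_j dot (v j) u).
  rewrite rmorph_prod; apply: eq_bigr => j _.
  have [-> -> ->] := coef_null_poly (v j); rewrite dotE.
  by apply: complex_eq => /=; field.
rewrite mulrBr -conic_liftZ -p'E /p' conic_liftZ conic_liftD.
rewrite -[RHS]/(complex.Re (toC (f u - c * \prod_j dot (v j) u))).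
congr (complex.Re _).
rewrite rmorphB rmorphM /=.
have h : toC 2^-1 * 2 = 1.
  by rewrite -(rmorph_nat toC) -rmorphM mulVf // pnatr_eq0.
set A := conic_lift X Y Z _ p u; set B := conic_lift X Y Z _ _ u.
set F : C := toC (f u); set G : C := toC (\prod_j _); set c' : C := toC c.
set h' : C := toC 2^-1.
transitivity (h' * 2 * F - c' * G); last by rewrite h mul1r.
ring.
Qed.

(** * Uniqueness on the sphere *)

(** The linear form with coefficients [v] at a point with coordinates in [K]. *)
Definition hdot (K : comNzRingType) (io : R -> K) (v : 'rV[R]_3) (x y z : K) :=
  io (v 0 0) * x + io (v 0 1) * y + io (v 0 2%:R) * z.

(** A sum of products composed with the stereographic projection
    [(a, b) |-> (2 a, 2 b, a^2 + b^2 - 1) / (a^2 + b^2 + 1)], after clearing the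
    denominators. *)
Definition stereo (K : comNzRingType) (io : R -> K) d (lam : R)
    (v : forall k : nat, 'I_k.+1 -> 'rV[R]_3) (a b : K) : K :=
  let N := a ^+ 2 + b ^+ 2 + 1 in
  io lam * N ^+ d + \sum_(k < d) N ^+ (d - k.+1) *
    \prod_j hdot io (v k j) (2%:R * a) (2%:R * b) (a ^+ 2 + b ^+ 2 - 1).

Lemma rmorph_stereo (K L : comNzRingType) (f : {rmorphism K -> L}) io d lam v a b :
  f (@stereo K io d lam v a b) = stereo (fun x => f (io x)) d lam v (f a) (f b).
Proof.
rewrite /stereo /hdot rmorphD rmorphM !rmorphXn !rmorphD rmorph1 !rmorphXn.
congr (_ + _); rewrite rmorph_sum; apply: eq_bigr => k _.
rewrite rmorphM !rmorphXn !rmorphD rmorph1 !rmorphXn; congr (_ * _).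
rewrite rmorph_prod; apply: eq_bigr => j _.
by rewrite !(rmorphD, rmorphM, rmorphN, rmorphXn, rmorph1, rmorph_nat).
Qed.

Lemma stereo_real d lam v (a b : R) :
  let N := a ^+ 2 + b ^+ 2 + 1 in
  let u : 'rV[R]_3 :=
    \row_i [:: 2 * a / N; 2 * b / N; (a ^+ 2 + b ^+ 2 - 1) / N]`_i in
  sphere u /\
  stereo id d lam v a b = N ^+ d * (lam + \sum_(k < d) \prod_j dot (v k j) u).
Proof.
move=> N u.
have N0 : N != 0 by rewrite gt_eqF // ltr_wpDl // addr_ge0 ?sqr_ge0.
split.
  rewrite (@ord3_sum _ _ 0 1 2%:R) // !mxE /=.
  by move: N0; rewrite /N => N0; field.
rewrite /stereo -/N mulrDr mulrC; congr (_ + _); rewrite mulr_sumr.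
apply: eq_bigr => k _.
have -> : N ^+ d = N ^+ (d - k.+1) * N ^+ k.+1 by rewrite -exprD subnK.
rewrite -mulrA; congr (_ * _).
have -> : N ^+ k.+1 = \prod_(j < k.+1) N by rewrite prodr_const card_ord.
rewrite -big_split; apply: eq_bigr => j _.
by rewrite /hdot dotE !mxE /=; field.
Qed.

(** A polynomial identity that holds at all real parameters holds at all complex
    ones; the two parameters are extended one after the other. *)
Lemma stereo_complex d lam lam' (v v' : forall k : nat, 'I_k.+1 -> 'rV[R]_3) :
  (forall u : 'rV[R]_3, sphere u -> lam + \sum_(k < d) \prod_j dot (v k j) u =
     lam' + \sum_(k < d) \prod_j dot (v' k j) u) ->
  forall a b : C, stereo toC d lam v a b = stereo toC d lam' v' a b.
Proof.
move=> E.
have RR (a b : R) : stereo toC d lam v (toC a) (toC b) =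
    stereo toC d lam' v' (toC a) (toC b).
  have [Su e] := stereo_real d lam v a b; have [_ e'] := stereo_real d lam' v' a b.
  have := congr1 toC (etrans e (etrans (congr1 _ (E _ Su)) (esym e'))).
  by rewrite !(rmorph_stereo toC).
have RC (a : R) (b : C) :
    stereo toC d lam v (toC a) b = stereo toC d lam' v' (toC a) b.
  pose P l w : {poly C} := stereo (fun x => (toC x)%:P) d l w (toC a)%:P 'X.
  have PE l w t : (P l w).[t] = stereo toC d l w (toC a) t.
    transitivity (stereo (fun x => (toC x)%:P.[t]) d l w (toC a)%:P.[t] 'X.[t]).
      exact: (rmorph_stereo (horner_eval t)).
    rewrite hornerX hornerC; congr (stereo _ _ _ _ _ _).
    by apply: funext => x; rewrite hornerC.
  rewrite -!PE; congr (_.[b]); apply/eqP; rewrite -subr_eq0; apply/eqP.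
  apply: (poly_vanishing_eq0 (@complexI R)) => x.
  by rewrite hornerD hornerN !PE RR subrr.
move=> a b; pose P l w : {poly C} := stereo (fun x => (toC x)%:P) d l w 'X b%:P.
have PE l w t : (P l w).[t] = stereo toC d l w t b.
  transitivity (stereo (fun x => (toC x)%:P.[t]) d l w 'X.[t] b%:P.[t]).
    exact: (rmorph_stereo (horner_eval t)).
  rewrite hornerX hornerC; congr (stereo _ _ _ _ _ _).
  by apply: funext => x; rewrite hornerC.
rewrite -!PE; congr (_.[a]); apply/eqP; rewrite -subr_eq0; apply/eqP.
apply: (poly_vanishing_eq0 (@complexI R)) => x.
by rewrite hornerD hornerN !PE RC subrr.
Qed.

Lemma horner_null_poly (v : 'rV[R]_3) (t : C) :
  (null_poly v).[t] = (toC (v 0 0) - 'i%C * toC (v 0 1)) / 2%:R +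
    toC (v 0 2%:R) * t - (toC (v 0 0) + 'i%C * toC (v 0 1)) / 2%:R * t ^+ 2.
Proof.
rewrite /null_poly hornerD hornerN hornerD hornerC !hornerZ hornerX hornerXn.
rewrite -(rmorph_nat toC) -fmorphV.
congr (_ + _ - _ * _); apply: complex_eq => /=; ring.
Qed.

(** At the points where the denominator of the stereographic projection vanishes
    only the leading products survive. *)
Lemma leading_null_poly d lam lam' (v v' : forall k : nat, 'I_k.+1 -> 'rV[R]_3) :
  (forall u : 'rV[R]_3, sphere u -> lam + \sum_(k < d.+1) \prod_j dot (v k j) u =
     lam' + \sum_(k < d.+1) \prod_j dot (v' k j) u) ->
  \prod_j null_poly (v d j) = \prod_j null_poly (v' d j).
Proof.
move=> /stereo_complex E; apply: poly_eq_off0 => t t0.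
have two0 : (2 : C) != 0 by rewrite pnatr_eq0.
(* The point [(2 a, 2 b, - 2)] is [- 2 / t] times the point of parameter [t]. *)
pose a : C := - (1 - t ^+ 2) / (2 * t).
pose b : C := 'i%C * (1 + t ^+ 2) / (2 * t).
have i2 : ('i%C : C) ^+ 2 = -1 by rewrite sqr_i.
have N0 : a ^+ 2 + b ^+ 2 + 1 = 0.
  have -> : b ^+ 2 = ('i%C : C) ^+ 2 * ((1 + t ^+ 2) / (2 * t)) ^+ 2.
    by rewrite -exprMn mulrA.
  rewrite i2 /a; move: t0 two0; clear=> t0 two0; field.
  by rewrite t0.
have top l w : stereo toC d.+1 l w a b =
    \prod_j hdot toC (w d j) (2%:R * a) (2%:R * b) (a ^+ 2 + b ^+ 2 - 1).
  rewrite /stereo N0 expr0n mulr0 add0r big_ord_recr /= subnn expr0 mul1r.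
  rewrite big1 ?add0r // => k _.
  rewrite expr0n (_ : (_ - _ == 0)%N = false) ?mul0r //.
  by have := ltn_ord k; lia.
have N2 : a ^+ 2 + b ^+ 2 - 1 = - 2%:R.
  by rewrite -[a ^+ 2 + b ^+ 2](addrK 1) N0; ring.
have pE (w : forall k : nat, 'I_k.+1 -> 'rV[R]_3) :
    (\prod_j null_poly (w d j)).[t] = (- t / 2%:R) ^+ d.+1 *
      \prod_j hdot toC (w d j) (2%:R * a) (2%:R * b) (- 2%:R).
  transitivity (\prod_(j < d.+1) (- t / 2%:R *
      hdot toC (w d j) (2%:R * a) (2%:R * b) (- 2%:R))); last first.
    by rewrite big_split /= prodr_const card_ord.
  rewrite horner_prod; apply: eq_bigr => j _; rewrite horner_null_poly /hdot.
  move: (toC _) (toC _) (toC _) => x y z.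
  by rewrite /a /b; field.
by rewrite !pE; congr (_ * _); move: (E a b); rewrite !top N2.
Qed.

(** The orbit relation on families of factors, all families with a zero factor
    being identified. *)
Definition same_factors k (v v' : 'I_k -> 'rV[R]_3) : Prop :=
  ((exists j, v j = 0) /\ (exists j, v' j = 0)) \/
  exists (s : 'S_k) (l : 'I_k -> R),
    \prod_j l j = 1 /\ forall j, v' j = l j *: v (s j).

Lemma dot0 (u : 'rV[R]_3) : dot 0 u = 0.
Proof. by rewrite dotE !mxE; ring. Qed.

Lemma same_factors_prod k (v v' : 'I_k -> 'rV[R]_3) u :
  same_factors v v' -> \prod_j dot (v j) u = \prod_j dot (v' j) u.
Proof.
case=> [[[i vi] [j vj]]|[s [l [l1 v'E]]]].
  rewrite (bigD1 i) // (bigD1 j (P := xpredT) (F := fun j => dot (v' j) u)) //=.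
  by rewrite vi vj dot0 !mul0r.
transitivity (\prod_j l j * \prod_j dot (v (s j)) u).
  by rewrite l1 mul1r (reindex_inj (@perm_inj _ s)).
by rewrite -big_split; apply: eq_bigr => j _; rewrite v'E dotZ.
Qed.

Lemma null_poly_prod_eq0 k (v : 'I_k -> 'rV[R]_3) :
  \prod_j null_poly (v j) = 0 -> exists j, v j = 0.
Proof. by move/eqP/prodf_eq0 => [j _ /eqP/null_poly_eq0]; exists j. Qed.

Lemma null_poly0 : null_poly (0 : 'rV[R]_3) = 0.
Proof. by rewrite -(scale0r (0 : 'rV[R]_3)) null_polyZ rmorph0 scale0r. Qed.

Lemma same_null_poly k (v v' : 'I_k -> 'rV[R]_3) :
  \prod_j null_poly (v j) = \prod_j null_poly (v' j) -> same_factors v v'.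
Proof.
move=> E; have [p0|p0] := eqVneq (\prod_j null_poly (v j)) 0.
  by left; split; apply: null_poly_prod_eq0; rewrite -?E.
right; apply: null_factorisation_unique => [j|j|]; last by rewrite rmorph1 scale1r.
  by apply: contraNneq p0 => vj; rewrite (bigD1 j) //= vj null_poly0 mul0r.
rewrite E in p0; apply: contraNneq p0 => vj.
by rewrite (bigD1 j) //= vj null_poly0 mul0r.
Qed.

Lemma sphere_unique d lam lam' (v v' : forall k : nat, 'I_k.+1 -> 'rV[R]_3) :
  (forall u : 'rV[R]_3, sphere u -> lam + \sum_(k < d) \prod_j dot (v k j) u =
     lam' + \sum_(k < d) \prod_j dot (v' k j) u) ->
  lam = lam' /\ forall k, (k < d)%N -> same_factors (v k) (v' k).
Proof.
elim: d => [|d IHd] E.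
  split=> //; have := E (delta_mx 0 0); rewrite !big_ord0 !addr0; apply.
  rewrite (bigD1 0) //= big1 => [|i /negPf i0]; rewrite mxE ?i0 ?expr0n //.
  by rewrite !eqxx expr1n addr0.
have same := same_null_poly (leading_null_poly E).
have [] := IHd => [u /E|-> vv'].
  rewrite [\sum_(k < d.+1) _]big_ord_recr [X in _ = _ + X]big_ord_recr /= !addrA.
  by rewrite (same_factors_prod u same) => /addIr.
by split=> // k; rewrite ltnS leq_eqVlt => /predU1P[->|/vv'].
Qed.

End Sphere.

(** * Transport to an arbitrary quadric *)

Section Transport.
Variable R : realType.
Implicit Types (P Q : {mpoly R[3]}) (u w : 'rV[R]_3).

Lemma dot_mulmx (v u : 'rV[R]_3) (M : 'M[R]_3) :
  dot v (u *m M) = dot (v *m M^T) u.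
Proof.
have E (x y : 'rV[R]_3) : dot x y = (x *m y^T) 0 0.
  by rewrite mxE; apply: eq_bigr => i _; rewrite mxE.
by rewrite !E trmx_mul mulmxA.
Qed.

Lemma deg_lt_mpoly (S : 'rV[R]_3 -> Prop) (B : 'M[R]_3) P k : (msize P <= k)%N ->
  deg_lt idfun S k (fun u => P.@[(u *m B) 0]).
Proof.
move=> Pk; pose F m u := P@_m * \prod_i (u *m B) 0 i ^+ m i.
have /deg_lt_ext : deg_lt idfun S k
    (fun u => \sum_(m <- msupp P | m \in msupp P) F m u).
  apply: deg_lt_sum => m mP; apply: deg_ltZ.
  apply: (@deg_ltW _ _ _ _ (mdeg m).+1); first exact: leq_trans (msize_mdeg_lt mP) Pk.
  have lin i : linear_form idfun (fun u => (u *m B) 0 i).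
    by exists (fun j => B j i) => u; rewrite mxE; apply: eq_bigr => j _; rewrite mulrC.
  have := deg_lt_linearX (m 0) (lin 0) (deg_lt_linearX (m 1) (lin 1)
    (deg_lt_linearX (m 2%:R) (lin 2%:R) (deg_ltC idfun S 0 1))).
  rewrite mdegE (@ord3_sum _ _ 0 1 2%:R) // addn1 !addnS addnA.
  move/deg_lt_ext; apply=> u _; rewrite !big_ord_recl big_ord0.
  by congr (_ * (_ * (_ * _))); congr (_ 0 _ ^+ m _); apply: val_inj.
apply=> u _; rewrite mevalE [RHS]big_seq_cond.
by apply: eq_bigl => m; rewrite andbT.
Qed.

Lemma represents_exists Q P (S : 'rV[R]_3 -> Prop) (B : 'M[R]_3) d :
  B \in unitmx -> (forall u, Q.@[(u *m B) 0] = 1 -> S u) -> leading_products S ->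
  (msize P <= d.+1)%N ->
  exists (lam : R) (v : forall k : 'I_d, {ffun 'I_k.+1 -> 'rV[R]_3}),
    represents Q P lam v.
Proof.
move=> Bu QS lead Pd.
have [lam [v vE]] := leading_products_sum lead (deg_lt_mpoly S B Pd).
exists lam, (fun k => [ffun j : 'I_k.+1 => v k j *m (invmx B)^T]) => u Qu.
rewrite -{1}(mulmxKV Bu u) vE; last by apply: QS; rewrite mulmxKV.
congr (_ + _); apply: eq_bigr => k _; rewrite meval_linprod.
by apply: eq_bigr => j _; rewrite ffunE dot_mulmx.
Qed.

Lemma linprod_zero k (v : {ffun 'I_k -> 'rV[R]_3}) j : v j = 0 -> linprod v = 0.
Proof.
move=> vj; rewrite /linprod (bigD1 j) //= vj /linform big1 ?mul0r // => i _.
by rewrite mxE scale0r.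
Qed.

Lemma linprod_eq0 k (v : {ffun 'I_k -> 'rV[R]_3}) :
  linprod v = 0 -> exists j, v j = 0.
Proof.
move/eqP/prodf_eq0 => [j _ /eqP v0]; exists j; apply/rowP => i.
have := meval_linform (v j) (delta_mx 0 i); rewrite v0 meval0 (bigD1 i) //= big1.
  by rewrite !mxE !eqxx mulr1 addr0 => <-.
by move=> l /negPf li; rewrite !mxE li mulr0.
Qed.

Lemma same_factors_multipliers k (M : 'M[R]_3) (v v' : {ffun 'I_k -> 'rV[R]_3}) :
  M \in unitmx ->
  same_factors (fun j => v j *m M) (fun j => v' j *m M) -> same_multipliers v v'.
Proof.
move=> Mu; have injM (x y : 'rV[R]_3) : x *m M = y *m M -> x = y.
  by move=> xy; rewrite -(mulmxK Mu x) xy mulmxK.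
have M0 (x : 'rV[R]_3) : x *m M = 0 -> x = 0.
  by move=> x0; apply: injM; rewrite mul0mx.
case=> [[[i /M0 vi] [j /M0 vj]]|[s [l [l1 v'E]]]]; first left.
  by split; [exact: linprod_zero vi|exact: linprod_zero vj].
by right; exists s, l; split=> // j; apply: injM; rewrite v'E scalemxAl.
Qed.

(** Families of factors are extended to all degrees before comparing them. *)
Lemma represents_unique Q P (B : 'M[R]_3) d lam lam'
    (v v' : forall k : 'I_d, {ffun 'I_k.+1 -> 'rV[R]_3}) :
  B \in unitmx -> (forall u, Q.@[(u *m B) 0] = \sum_i u 0 i ^+ 2) ->
  represents Q P lam v -> represents Q P lam' v' ->
  lam = lam' /\ forall k, same_multipliers (v k) (v' k).
Proof.
move=> Bu QB vP v'P.
have extend (w : forall k : 'I_d, {ffun 'I_k.+1 -> 'rV[R]_3}) :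
    {w' : forall k : nat, 'I_k.+1 -> 'rV[R]_3 |
      forall k : 'I_d, w' k = (fun j => w k j *m B^T)}.
  have h (k : nat) : exists w' : 'I_k.+1 -> 'rV[R]_3, forall kd : (k < d)%N,
      w' = (fun j => w (Ordinal kd) j *m B^T).
    have [kd|dk] := pselect (is_true (k < d)%N); last by exists (fun=> 0).
    exists (fun j => w (Ordinal kd) j *m B^T) => kd'.
    by rewrite (bool_irrelevance kd kd').
  exists (fun k => sval (cid (h k))) => -[k kd] /=.
  by case: (cid _) => w' /= ->.
have [w wE] := extend v; have [w' w'E] := extend v'.
have [|-> same] := @sphere_unique R d lam lam' w w'; last first.
  split=> // k; have := same k (ltn_ord k); rewrite wE w'E.
  by apply: same_factors_multipliers; rewrite unitmx_tr.
move=> u Su.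
have Qu : quadric Q (u *m B) by rewrite /quadric /= QB.
have E l (z : forall k : 'I_d, {ffun 'I_k.+1 -> 'rV[R]_3})
    (z' : forall k : nat, 'I_k.+1 -> 'rV[R]_3) :
    (forall k : 'I_d, z' k = (fun j => z k j *m B^T)) -> represents Q P l z ->
    P.@[(u *m B) 0] = l + \sum_(k < d) \prod_j dot (z' k j) u.
  move=> zz /(_ _ Qu) ->; congr (_ + _); apply: eq_bigr => k _.
  by rewrite meval_linprod zz; apply: eq_bigr => j _; rewrite dot_mulmx.
by rewrite -(E _ _ _ wE vP) -(E _ _ _ w'E v'P).
Qed.

Lemma same_multipliers_multipole k (v v' : {ffun 'I_k -> 'rV[R]_3}) :
  same_multipliers v v' -> multipole_of v = multipole_of v'.
Proof.
have none (w : {ffun 'I_k -> 'rV[R]_3}) j : w j = 0 -> multipole_of w = None.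
  move=> wj; rewrite /multipole_of insubN //; apply/forallPn.
  by exists j; rewrite wj eqxx.
case=> [[/linprod_eq0[i vi] /linprod_eq0[j v'j]]|vv'].
  by rewrite (none _ _ vi) (none _ _ v'j).
have [[j vj]|v0] := pselect (exists j, v j = 0).
  have [s [l [_ v'E]]] := vv'; rewrite (none _ _ vj) (none v' ((s^-1)%g j)) //.
  by rewrite v'E permKV vj scaler0.
have v_neq0 : [forall j, v j != 0].
  by apply/forallP => j; apply/eqP => vj; apply: v0; exists j.
have v'_neq0 : [forall j, v' j != 0].
  apply/forallP => j; apply/eqP => v'j; apply: v0.
  have [s [l [_ vE]]] := reorder_rescale_sym vv'.
  by exists ((s^-1)%g j); rewrite vE permKV v'j scaler0.
rewrite /multipole_of !insubT /=; congr Some.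
by apply/eqmodP/asboolP.
Qed.

(** A negative diagonal entry makes the quadric empty or unbounded. *)
Lemma ellipsoid_positive Q (A : 'M[R]_3) (d : 'rV[R]_3) : A \in unitmx ->
  (forall u, Q.@[(u *m A) 0] = \sum_(i < 3) d 0 i * u 0 i ^+ 2) ->
  (forall i, d 0 i != 0) -> is_ellipsoid (quadric Q) -> forall i, 0 < d 0 i.
Proof.
move=> Au QA d0 [M [c [Mu QE]]] m; rewrite lt_neqAle eq_sym d0 leNgt.
apply/negP => dm.
have [l dl] : exists l, 0 < d 0 l.
  apply: contrapT => npos.
  have : quadric Q (delta_mx 0 0 *m M + c).
    rewrite QE; exists (delta_mx 0 0) => //; rewrite /unit_sphere /=.
    rewrite (bigD1 0) //= big1 => [|i /negPf i0]; rewrite mxE ?i0 ?expr0n //.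
    by rewrite !eqxx expr1n addr0.
  rewrite /quadric /= -[_ + c](mulmxKV Au) QA => /eqP; apply/negP.
  rewrite lt_eqF // (le_lt_trans _ ltr01) // sumr_le0 // => i _.
  rewrite mulr_le0_ge0 ?sqr_ge0 // leNgt; apply/negP => di; apply: npos; by exists i.
have lm : m != l by apply: contraTneq dl => <-; rewrite -leNgt ltW.
pose T i := (M *m invmx A) i m; pose c0 := (c *m invmx A) 0 m.
(* [y] exceeds the [m]-th diagonal coordinate of every point of the ellipsoid. *)
pose y := \sum_i `|T i| + `|c0| + 1.
pose x := Num.sqrt ((1 - d 0 m * y ^+ 2) / d 0 l).
have x2 : d 0 l * x ^+ 2 = 1 - d 0 m * y ^+ 2.
  rewrite sqr_sqrtr; first by rewrite mulrC divfK.
  rewrite divr_ge0 ?(ltW dl) // subr_ge0 (le_trans _ ler01) //.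
  by rewrite mulr_le0_ge0 ?sqr_ge0 // ltW.
pose w : 'rV[R]_3 := \row_i (if i == m then y else if i == l then x else 0).
have : quadric Q (w *m A).
  have [k mk lk] := ord3_third m l.
  rewrite /quadric /= QA (ord3_sum _ lm mk lk) !mxE !eqxx.
  rewrite (eq_sym l) (negPf lm) !(eq_sym k) (negPf mk) (negPf lk) x2.
  by ring.
rewrite QE => -[s /= s1 sE].
have yE : y = \sum_i s 0 i * T i + c0.
  have : (w *m A *m invmx A) 0 m = y by rewrite mulmxK // mxE eqxx.
  by rewrite -sE mulmxDl -mulmxA mxE [(s *m _) 0 m]mxE => <-.
have s_le1 i : `|s 0 i| <= 1.
  rewrite -(@expr_le1 _ 2) // real_normK ?num_real // -s1.
  by rewrite (bigD1 i) //= lerDl sumr_ge0 // => j _; rewrite sqr_ge0.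
have : y <= \sum_i `|T i| + `|c0|.
  rewrite yE lerD ?ler_norm //; apply: ler_sum => i _.
  by rewrite (le_trans (ler_norm _)) // normrM ler_piMl.
by rewrite /y gerDl ler10.
Qed.

End Transport.

Theorem theorem13 (R : realType) (Q : {mpoly R[3]}) (s : int)
    (hQ : Q \is 2.-homog) (hirr : irreducible_over_C Q)
    (hsign : has_signature Q s) (hs : s <> -3)
    (d : nat) (P : {mpoly R[3]}) (hP : (msize P).-1 = d) :
  (exists (lam : R) (v : forall k : 'I_d, {ffun 'I_k.+1 -> 'rV[R]_3}),
      represents Q P lam v) /\
  (is_ellipsoid (quadric Q) ->
     (forall (lam lam' : R)
             (v v' : forall k : 'I_d, {ffun 'I_k.+1 -> 'rV[R]_3}),
         represents Q P lam v -> represents Q P lam' v' ->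
         lam = lam' /\ forall k : 'I_d, same_multipliers (v k) (v' k)) /\
     (exists! w : forall k : 'I_d, multipole_bar R k.+1,
        exists (lam : R) (v : forall k : 'I_d, {ffun 'I_k.+1 -> 'rV[R]_3}),
          represents Q P lam v /\
          forall k : 'I_d, w k = multipole_of (v k))).
Proof.
have [A [e [Au QA sE]]] := hsign.
have e0 i : e 0 i != 0 by exact: irreducible_diagonal_neq0 Au QA i hirr.
have Pd : (msize P <= d.+1)%N by rewrite -hP leqSpred.
split.
  have [e_pos|] := pselect (forall i, 0 < e 0 i).
    have [B Bu QB] := definite_normal_form Au QA e_pos.
    apply: represents_exists Bu _ (@definite_leading_products R) Pd => u.
    by rewrite QB.
  move/existsNP => [j /negP]; rewrite -leNgt le_eqVlt (negPf (e0 j)) /= => ej.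
  have [[i ei]|npos] := pselect (exists i, 0 < e 0 i).
    have [B [eps [Bu eps2] QB]] := indefinite_normal_form Au QA e0 ei ej.
    apply: represents_exists Bu _ (indefinite_leading_products eps2) Pd => u.
    by rewrite QB.
  case: hs; rewrite sE.
  have neg i : sgz (e 0 i) = -1.
    apply: ltr0_sgz; rewrite lt_neqAle e0 leNgt.
    by apply/negP => ei; apply: npos; exists i.
  by rewrite (eq_bigr _ (fun i _ => neg i)) sumr_const card_ord.
move=> ell.
have [B Bu QB] := definite_normal_form Au QA (ellipsoid_positive Au QA e0 ell).
have uniq lam lam' v v' : represents Q P lam v -> represents Q P lam' v' ->
    lam = lam' /\ forall k : 'I_d, same_multipliers (v k) (v' k).
  exact: represents_unique Bu QB.
split; first exact: uniq.
have [lam [v vP]] : exists (lam : R)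
    (v : forall k : 'I_d, {ffun 'I_k.+1 -> 'rV[R]_3}), represents Q P lam v.
  apply: represents_exists Bu _ (@definite_leading_products R) Pd => u.
  by rewrite QB.
exists (fun k => multipole_of (v k)); split; first by exists lam, v.
move=> w [lam' [v' [v'P wE]]]; apply: functional_extensionality_dep => k.
rewrite wE; have [_ same] := uniq _ _ _ _ vP v'P.
exact: same_multipliers_multipole.
Qed.
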